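(* Consider system (S) with $\alpha=0$ and with injected field of the form $u=\lambda\widehat u$, where $\lambda\in\mathbb{C}\setminus\{0\}$ and $\widehat u=(\widehat u_-,\widehat u_+)\in\mathbb{C}^2$ satisfies $\widehat u_-\neq0$ and $\widehat u_+\neq0$. Let $\ell>0$ and let $E^{(j)}_{\widehat u}:\{\lambda\in\mathbb{C}:0<|\lambda|<\ell\}\to\mathbb{C}^2$, $j\in\mathcal J=\{0,\pm\mathrm{L},\pm\mathrm{R},\pm\mathrm{X},\pm\mathrm{Y}\}$, be nine continuous functions with pairwise distinct values which determine the equilibrium points of (S) and have the asymptotics as $\lambda\to0$ in the sense of properties (P1) and (P2) of the context. Then there exists a constant $0<\ell_0\le\ell$ such that for every $\lambda$ with $0<|\lambda|<\ell_0$, the equilibrium point of (S) (with $u=\lambda\widehat u$) corresponding to $E^{(+\mathrm X)}_{\widehat u}(\lambda)$ is asymptotically stable, and the other eight equilibrium points, corresponding to $E^{(j)}_{\widehat u}(\lambda)$ with $j\in\{0,\pm\mathrm L,\pm\mathrm R,-\mathrm X,\pm\mathrm Y\}$, are unstable.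
   Context: Fixed real parameters: $\kappa,\gamma,\delta\in(0,\infty)$, $\mu>1$, and (in this statement) $\alpha=0$. For $z=(z_1,z_2)\in\mathbb{C}^2$ define $$X(z):=\begin{bmatrix}1-(z_1-z_2)&0\\0&1-(z_1+z_2)\end{bmatrix},\qquad Y(z):=\begin{bmatrix}1+|z|^2&|z_2|^2-|z_1|^2\\ |z_2|^2-|z_1|^2&\delta+|z|^2\end{bmatrix}.$$ For a constant $u=(u_-,u_+)\in\mathbb{C}^2$, system (S) is the following system of ODEs for $E(t)=(E_-(t),E_+(t))\in\mathbb{C}^2$ and $N(t),n(t)\in\mathbb{R}$: $$\frac{d}{dt}E=-\kappa\big((1+i\alpha)X(N,n)E-u\big),\qquad \frac{d}{dt}\begin{bmatrix}N\\ n\end{bmatrix}=-\gamma\Big(Y(E)\begin{bmatrix}N\\ n\end{bmatrix}-\begin{bmatrix}\mu\\0\end{bmatrix}\Big).\tag{S}$$ An equilibrium point of (S) is a triple $(E,N,n)\in\mathbb{C}^2\times\mathbb{R}\times\mathbb{R}$ at which both right-hand sides vanish. Stability is understood in the sense of Lyapunov for (S), regarded as an autonomous ODE on $\mathbb{R}^6\cong\mathbb{C}^2\times\mathbb{R}\times\mathbb{R}$; unstable means not Lyapunov stable. The function $y:\mathbb{R}^2\to\mathbb{R}^2$ is $y(x):=Y(x)^{-1}(\mu,0)^T$ (note $\det Y(x)=\delta+(1+\delta)|x|^2+4x_1^2x_2^2>0$). (P1) If $u=\lambda\widehat u$ with $0<|\lambda|<\ell$, then $(E,N,n)$ is an equilibrium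 point of (S) if and only if $E=E^{(j)}_{\widehat u}(\lambda)$ for some $j\in\mathcal J$ and $(N,n)=y(|E_-|,|E_+|)$. The equilibrium point corresponding to $E^{(j)}_{\widehat u}(\lambda)$ is the one with $E=E^{(j)}_{\widehat u}(\lambda)$, $(N,n)=y(|E_-|,|E_+|)$. (P2) As $\lambda\to0$ (here $\alpha=0$), $$E^{(0)}_{\widehat u}(\lambda)=\tfrac{\lambda}{|\lambda|}\big(|\lambda|\widehat w^{(0)}+o(\lambda)\big),$$ $$E^{(\pm\mathrm L)}_{\widehat u}(\lambda)=\tfrac{\lambda}{|\lambda|}\Big(\pm\sqrt{\tfrac{\delta(\mu-1)}{1+\delta}}\begin{bmatrix}\widehat u_-/|\widehat u_-|\\0\end{bmatrix}+|\lambda|\widehat w^{(\mathrm L)}+o(\lambda)\Big),\quad E^{(\pm\mathrm R)}_{\widehat u}(\lambda)=\tfrac{\lambda}{|\lambda|}\Big(\pm\sqrt{\tfrac{\delta(\mu-1)}{1+\delta}}\begin{bmatrix}0\\ \widehat u_+/|\widehat u_+|\end{bmatrix}+|\lambda|\widehat w^{(\mathrm R)}+o(\lambda)\Big),$$ $$E^{(\pm\mathrm X)}_{\widehat u}(\lambda)=\tfrac{\lambda}{|\lambda|}\Big(\pm\sqrt{\tfrac{\mu-1}{2}}\begin{bmatrix}\widehat u_-/|\widehat u_-|\\ \widehat u_+/|\widehat u_+|\end{bmatrix}+|\lambda|\widehat w^{(\mathrm X)}+o(\lambda)\Big),\quad E^{(\pm\mathrm Y)}_{\widehat u}(\lambda)=\tfrac{\lambda}{|\lambda|}\Big(\pm\sqrt{\tfrac{\mu-1}{2}}\begin{bmatrix}\widehat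 u_-/|\widehat u_-|\\ -\widehat u_+/|\widehat u_+|\end{bmatrix}+|\lambda|\widehat w^{(\mathrm Y)}+o(\lambda)\Big),$$ where $$\widehat w^{(0)}=\tfrac{-1}{\mu-1}\widehat u,\quad \widehat w^{(\mathrm L)}=\tfrac{1}{2(\mu-1)}\begin{bmatrix}\mu\widehat u_-\\ -(1+\delta)\widehat u_+\end{bmatrix},\quad \widehat w^{(\mathrm R)}=\tfrac{1}{2(\mu-1)}\begin{bmatrix}-(1+\delta)\widehat u_-\\ \mu\widehat u_+\end{bmatrix},$$ $$\widehat w^{(\mathrm X)}=\tfrac{1}{4(\mu-1)}\begin{bmatrix}(2\mu+\delta-1+(1-\delta)|\widehat u_+|/|\widehat u_-|)\widehat u_-\\ ((1-\delta)|\widehat u_-|/|\widehat u_+|+2\mu+\delta-1)\widehat u_+\end{bmatrix},\quad \widehat w^{(\mathrm Y)}=\tfrac{1}{4(\mu-1)}\begin{bmatrix}(2\mu+\delta-1+(\delta-1)|\widehat u_+|/|\widehat u_-|)\widehat u_-\\ ((\delta-1)|\widehat u_-|/|\widehat u_+|+2\mu+\delta-1)\widehat u_+\end{bmatrix}.$$ (The paper establishes separately that such $\ell$ and such a family exist.) *)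

(* Defs.v *)
From Stdlib Require Import Reals.
From Coquelicot Require Import Coquelicot.
Open Scope R_scope.

(** ** Stability of equilibria of autonomous ODEs x' = F(x) *)

(** Solutions on [0, +oo): a map on R of which only the values on [0, +oo)
    matter; it is continuous on [0, +oo) (right-continuous at 0) and
    differentiable on (0, +oo). *)
Definition is_solution {V : NormedModule R_AbsRing}
    (F : V -> V) (phi : R -> V) : Prop :=
  (forall t : R, 0 < t -> is_derive phi t (F (phi t))) /\
  filterlim phi (at_right 0) (locally (phi 0)).

Definition is_equilibrium {V : NormedModule R_AbsRing}
    (F : V -> V) (p : V) : Prop :=
  F p = zero.

(** Existence of the solution for all positive times is part of stability; a
    maximal solution of a locally Lipschitz system on R^n that is not defined
    for all positive times leaves every ball. *)
Definition lyapunov_stable {V : NormedModule R_AbsRing}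
    (F : V -> V) (p : V) : Prop :=
  forall eps : R, 0 < eps -> exists d : R, 0 < d /\
    forall x0 : V, norm (minus x0 p) < d ->
      (exists phi : R -> V, is_solution F phi /\ phi 0 = x0) /\
      (forall phi : R -> V, is_solution F phi -> phi 0 = x0 ->
        forall t : R, 0 <= t -> norm (minus (phi t) p) < eps).

Definition attractive {V : NormedModule R_AbsRing}
    (F : V -> V) (p : V) : Prop :=
  exists d : R, 0 < d /\
    forall phi : R -> V, is_solution F phi -> norm (minus (phi 0) p) < d ->
      filterlim phi (Rbar_locally p_infty) (locally p).

Definition asymptotically_stable {V : NormedModule R_AbsRing}
    (F : V -> V) (p : V) : Prop :=
  lyapunov_stable F p /\ attractive F p.

Definition unstable {V : NormedModule R_AbsRing} (F : V -> V) (p : V) : Prop :=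
  ~ lyapunov_stable F p.

(** ** 2 x 2 matrices *)

Definition col {T : Type} (v : T * T) : @matrix T 2 1 :=
  [[fst v], [snd v]].

Definition uncol {T : Ring} (M : @matrix T 2 1) : T * T :=
  (coeff_mat zero M 0 0, coeff_mat zero M 1 0).

Definition mulmv {T : Ring} (A : @matrix T 2 2) (v : T * T) : T * T :=
  uncol (Mmult A (col v)).

Definition det2 (A : @matrix R 2 2) : R :=
  coeff_mat 0 A 0 0 * coeff_mat 0 A 1 1 - coeff_mat 0 A 0 1 * coeff_mat 0 A 1 0.

(** The inverse of A when det2 A <> 0, see [inv2_l] and [inv2_r]. *)
Definition inv2 (A : @matrix R 2 2) : @matrix R 2 2 :=
  [[ coeff_mat 0 A 1 1 / det2 A, - coeff_mat 0 A 0 1 / det2 A ],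
   [ - coeff_mat 0 A 1 0 / det2 A, coeff_mat 0 A 0 0 / det2 A ]].

Lemma inv2_l (A : @matrix R 2 2) :
  det2 A <> 0 -> Mmult (T := R_Ring) (inv2 A) A = Mone.
Proof.
destruct A as [[a [b []]] [[c [d []]] []]].
cbv -[Rplus Rmult Rminus Ropp Rdiv Rinv IZR]; intros H.
repeat f_equal; field; exact H.
Qed.

Lemma inv2_r (A : @matrix R 2 2) :
  det2 A <> 0 -> Mmult (T := R_Ring) A (inv2 A) = Mone.
Proof.
destruct A as [[a [b []]] [[c [d []]] []]].
cbv -[Rplus Rmult Rminus Ropp Rdiv Rinv IZR]; intros H.
repeat f_equal; field; exact H.
Qed.

(** ** The laser system: rhs_E and rhs_N are the right-hand sides of the
    equations for E and for (N, n) *)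

(** C^2 as a complex normed space; E = (E_-, E_+), and likewise for u. *)
Definition C2 : NormedModule C_AbsRing :=
  prod_NormedModule C_AbsRing C_NormedModule C_NormedModule.

(** C^2 x (R x R) as a real normed space (isometric to Euclidean R^6); the
    points are ((E_-, E_+), (N, n)). *)
Definition state : NormedModule R_AbsRing :=
  prod_NormedModule R_AbsRing
    (prod_NormedModule R_AbsRing C_R_NormedModule C_R_NormedModule)
    (prod_NormedModule R_AbsRing R_NormedModule R_NormedModule).

Definition X (z : C * C) : @matrix C 2 2 :=
  [[ (1 - (fst z - snd z))%C, RtoC 0 ],
   [ RtoC 0, (1 - (fst z + snd z))%C ]].

Definition Y (delta : R) (z : C * C) : @matrix R 2 2 :=
  let q1 := Cmod (fst z) ^ 2 in
  let q2 := Cmod (snd z) ^ 2 in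
  [[ 1 + (q1 + q2), q2 - q1 ],
   [ q2 - q1, delta + (q1 + q2) ]].

Definition rhs_E (kappa alpha : R) (u : C * C) (E : C * C) (N n : R) : C * C :=
  opp (scal (RtoC kappa)
    (minus (scal (1 + Ci * alpha)%C
                 (mulmv (T := C_Ring) (X (RtoC N, RtoC n)) E : C2))
           (u : C2))).

Definition rhs_N (gamma delta mu : R) (E : C * C) (N n : R) : R * R :=
  opp (scal gamma
    (minus (mulmv (T := R_Ring) (Y delta E) (N, n)) (mu, 0))).

Definition rhs (kappa gamma delta mu alpha : R) (u : C * C) (p : state) : state :=
  let '(E, (N, n)) := p in
  (rhs_E kappa alpha u E N n, rhs_N gamma delta mu E N n).

(** y(x) = Y(x)^(-1) (mu, 0)^T for real x; det (Y x) > 0 when delta > 0, so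
    that the inverse is a genuine one. *)
Definition y (delta mu : R) (x : R * R) : R * R :=
  mulmv (T := R_Ring) (inv2 (Y delta (RtoC (fst x), RtoC (snd x)))) (mu, 0).

Definition state_of (delta mu : R) (E : C * C) : state :=
  (E, y delta mu (Cmod (fst E), Cmod (snd E))).

(** ** Branches of equilibrium points *)

(** The index set {0, +-L, +-R, +-X, +-Y}: [pL] is +L, [mL] is -L, etc. *)
Inductive branch : Set := b0 | pL | mL | pR | mR | pX | mX | pY | mY.

Definition phase (z : C) : C := (z / Cmod z)%C.

(** The branches satisfy
      E^(j)(lam) = lam/|lam| (leading j + |lam| what j + o(lam))
    as lam -> 0; [what j] is the same for both signs. *)
Definition leading (delta mu : R) (uh : C * C) (j : branch) : C2 :=
  let A := RtoC (sqrt (delta * (mu - 1) / (1 + delta))) in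
  let B := RtoC (sqrt ((mu - 1) / 2)) in
  let vL : C2 := (phase (fst uh), RtoC 0) in
  let vR : C2 := (RtoC 0, phase (snd uh)) in
  let vX : C2 := (phase (fst uh), phase (snd uh)) in
  let vY : C2 := (phase (fst uh), Copp (phase (snd uh))) in
  match j with
  | b0 => zero
  | pL => scal A vL | mL => opp (scal A vL)
  | pR => scal A vR | mR => opp (scal A vR)
  | pX => scal B vX | mX => opp (scal B vX)
  | pY => scal B vY | mY => opp (scal B vY)
  end.

Definition what (delta mu : R) (uh : C * C) (j : branch) : C2 :=
  let um := fst uh in
  let up := snd uh in
  let r := Cmod up / Cmod um in
  let r' := Cmod um / Cmod up in
  let k := 2 * mu + delta - 1 in
  match j with
  | b0 => scal (RtoC (-1 / (mu - 1))) (uh : C2)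
  | pL | mL =>
      scal (RtoC (1 / (2 * (mu - 1))))
        ((RtoC mu * um)%C, (RtoC (- (1 + delta)) * up)%C)
  | pR | mR =>
      scal (RtoC (1 / (2 * (mu - 1))))
        ((RtoC (- (1 + delta)) * um)%C, (RtoC mu * up)%C)
  | pX | mX =>
      scal (RtoC (1 / (4 * (mu - 1))))
        ((RtoC (k + (1 - delta) * r) * um)%C,
         (RtoC ((1 - delta) * r' + k) * up)%C)
  | pY | mY =>
      scal (RtoC (1 / (4 * (mu - 1))))
        ((RtoC (k + (delta - 1) * r) * um)%C,
         (RtoC ((delta - 1) * r' + k) * up)%C)
  end.

(** The functions E^(j) are total here, but only their values on the punctured
    disc are ever constrained or used. *)
Definition in_pdisc (l : R) (lam : C) : Prop := 0 < Cmod lam < l.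

Definition determines_equilibria
    (kappa gamma delta mu alpha : R) (uh : C * C) (l : R)
    (Eb : branch -> C -> C2) : Prop :=
  forall lam : C, in_pdisc l lam ->
  forall (E : C * C) (N n : R),
    is_equilibrium
      (rhs kappa gamma delta mu alpha (scal lam (uh : C2))) (E, (N, n)) <->
    exists j : branch,
      E = Eb j lam /\ (N, n) = y delta mu (Cmod (fst E), Cmod (snd E)).

(** [is_domin F f g] means g = o(f) along the filter F. *)
Definition has_asymptotics (delta mu : R) (uh : C * C) (l : R)
    (Eb : branch -> C -> C2) : Prop :=
  forall j : branch, exists rest : C -> C2,
    is_domin (Ku := C_AbsRing) (Kv := C_AbsRing) (U := C_NormedModule) (V := C2)
      (locally' (0 : C)) (fun lam : C => lam) rest /\
    forall lam : C, in_pdisc l lam ->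
      Eb j lam =
        scal (phase lam)
          (plus (plus (leading delta mu uh j)
                      (scal (RtoC (Cmod lam)) (what delta mu uh j)))
                (rest lam)).

(* Main.v *)
Require Import Defs.
From Stdlib Require Import Reals Lra Lia Classical ClassicalEpsilon.
From Stdlib Require Import FunctionalExtensionality.
From Coquelicot Require Import Coquelicot.
Open Scope R_scope.

(** Let a = 1 - (N - n) and b = 1 - (N + n) be the two diagonal entries of
    X(N, n), called gains below.  At an equilibrium a E_- = u_- and
    b E_+ = u_+, and the stability of the equilibrium can be read off the signs
    of the two gains, without linearisation.

    If a < 0, the quantity l = Im (conj (u_-) E_-) vanishes at the equilibrium
    and satisfies l' = - kappa a l exactly along every solution.  Near the
    equilibrium a remains negative, so that l grows exponentially as soon as it
    is not 0 initially: the equilibrium is unstable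
    ([unstable_of_negative_gain]).  The same holds for b and E_+.

    If both gains lie in (0, 1) at an equilibrium (E', N', n'), then
    V = (2 / kappa) ((1 - a) |E_- - E'_-|^2 + (1 - b) |E_+ - E'_+|^2)
        + (1 / gamma) ((N - N')^2 + (n - n')^2),
    where a and b are taken at the equilibrium, is a strict Lyapunov function.
    Its derivative along solutions can be computed in closed form and all terms
    mixing E and (N, n) at second order cancel ([energy_derive]); what remains
    is bounded by - c V in an explicit neighbourhood ([dissipation_bound]).
    Lyapunov's direct method ([lyapunov_direct]) then gives asymptotic
    stability.  Since stability includes the existence of global solutions, that
    theorem rests on a global Picard-Lindeloef theorem ([picard_lindelof])
    applied to the field composed with a retraction onto a ball.

    It remains to find the signs of the gains for small lam.  Dividing the
    equation a E_- = lam uh_- by the phase of lam uh_- and taking real parts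
    shows that a has the sign of the amplitude of E_- relative to that phase,
    and that it is of order |lam| if the amplitude tends to a nonzero limit.  On
    the branch +X both amplitudes tend to a positive limit, so that both gains
    are small and positive.  On each of the other eight branches at least one
    component has a negative leading amplitude, or a vanishing one and a
    negative first-order coefficient ([amp_nonpos], [what_m], [what_p]), and the
    corresponding gain is negative. *)

(** * Distances, Lipschitz functions and derivatives in normed modules *)

Lemma plus_minus_l {G : AbelianGroup} (x y : G) : minus (plus x y) x = y.
Proof.
change (minus (plus x y) x) with (plus (plus x y) (opp x)).
rewrite (plus_comm x), <- plus_assoc, plus_opp_r; apply plus_zero_r.
Qed.

Lemma plus_minus_r {G : AbelianGroup} (x y : G) : plus x (minus y x) = y.
Proof.
change (minus y x) with (plus y (opp x)).
rewrite (plus_comm y), plus_assoc, plus_opp_r; apply plus_zero_l.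
Qed.

Lemma minus_plus_l {G : AbelianGroup} (x y z : G) :
  minus (plus x y) (plus x z) = minus y z.
Proof.
rewrite (minus_trans x (plus x y)), plus_minus_l,
  <- (opp_minus (plus x z)), plus_minus_l.
reflexivity.
Qed.

(** A constant of its own fixes the structure at which the norm and the
    subtraction are read, which keeps terms over a complete normed module
    syntactically comparable with those over its underlying normed module. *)
Definition ndist {V : NormedModule R_AbsRing} (x y : V) : R := norm (minus x y).

Lemma filterlim_locally_norm {T : Type} {F : (T -> Prop) -> Prop} {FF : Filter F}
    {V : NormedModule R_AbsRing} (f : T -> V) (v : V) :
  filterlim f F (locally v) <->
  forall eps : R, 0 < eps -> F (fun x => ndist (f x) v < eps).
Proof.
split.
- intros H eps Heps.
  apply (H (fun w => ndist w v < eps)).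
  apply locally_le_locally_norm.
  exists (mkposreal eps Heps); intros w Hw; exact Hw.
- intros H P HP.
  apply locally_norm_le_locally in HP.
  destruct HP as [eps HP].
  apply filter_imp with (2 := H eps (cond_pos eps)).
  intros x Hx; apply HP; exact Hx.
Qed.

Lemma continuous_ndist {U : UniformSpace} {V : NormedModule R_AbsRing}
    (f : U -> V) (u : U) :
  continuous f u <->
  forall eps : R, 0 < eps -> locally u (fun x => ndist (f x) (f u) < eps).
Proof. exact (filterlim_locally_norm f (f u)). Qed.

Lemma ndist_sym {V : NormedModule R_AbsRing} (x y : V) :
  ndist x y = ndist y x.
Proof. unfold ndist; rewrite <- norm_opp, opp_minus; reflexivity. Qed.

Lemma ndist_triangle {V : NormedModule R_AbsRing} (x y z : V) :
  ndist x z <= ndist x y + ndist y z.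
Proof. unfold ndist; rewrite (minus_trans y x z); apply norm_triangle. Qed.

Lemma ndist_refl {V : NormedModule R_AbsRing} (x : V) :
  ndist x x = 0.
Proof. unfold ndist; rewrite minus_eq_zero; apply norm_zero. Qed.

Lemma ndist_ge_0 {V : NormedModule R_AbsRing} (x y : V) : 0 <= ndist x y.
Proof. apply norm_ge_0. Qed.

Lemma ndist_eq_0 {V : NormedModule R_AbsRing} (x y : V) : ndist x y <= 0 -> x = y.
Proof.
intros H; apply (plus_reg_r (opp y)); rewrite plus_opp_r.
apply norm_eq_zero, Rle_antisym; [exact H|apply norm_ge_0].
Qed.

Lemma ndist_plus_l {V : NormedModule R_AbsRing} (x y z : V) :
  ndist (plus x y) (plus x z) = ndist y z.
Proof. exact (f_equal norm (minus_plus_l (G := NormedModule.AbelianGroup _ V) x y z)). Qed.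

Lemma lipschitz_continuous {U V : NormedModule R_AbsRing} (G : U -> V) (L : R) :
  (forall x y, ndist (G x) (G y) <= L * ndist x y) ->
  forall x, continuous G x.
Proof.
intros HG x.
apply filterlim_locally_norm; intros eps Heps.
pose proof (Rabs_pos L) as HL.
assert (Hd : 0 < eps / (Rabs L + 1)) by (apply Rdiv_lt_0_compat; lra).
apply locally_le_locally_norm.
exists (mkposreal _ Hd); intros y Hy.
unfold ball_norm in Hy; simpl in Hy.
apply Rle_lt_trans with (1 := HG y x).
pose proof (Rle_abs L).
pose proof (ndist_ge_0 y x) as Hn.
apply Rle_lt_trans with ((Rabs L + 1) * ndist y x); [nra|].
apply Rmult_lt_reg_r with (/ (Rabs L + 1)).
- apply Rinv_0_lt_compat; lra.
- replace ((Rabs L + 1) * ndist y x * / (Rabs L + 1)) with (ndist y x)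
    by (field; lra).
  exact Hy.
Qed.

Section ProductComplete.
Variables U V : CompleteSpace.

(** A Cauchy filter on a product converges componentwise. *)
Definition prod_lim (F : (U * V -> Prop) -> Prop) : U * V :=
  (lim (filtermap fst F), lim (filtermap snd F)).

Lemma prod_complete_cauchy (F : (prod_UniformSpace U V -> Prop) -> Prop) :
  ProperFilter F -> cauchy F -> forall eps : posreal, F (ball (prod_lim F) eps).
Proof.
intros HF HC eps.
assert (H1 : F (fun z => ball (lim (filtermap fst F)) eps (fst z))).
{ apply (complete_cauchy (filtermap fst F)); [apply filtermap_proper_filter, HF|].
  intros e; destruct (HC e) as [z Hz]; exists (fst z).
  apply filter_imp with (2 := Hz); intros w [Hw _]; exact Hw. }
assert (H2 : F (fun z => ball (lim (filtermap snd F)) eps (snd z))).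
{ apply (complete_cauchy (filtermap snd F)); [apply filtermap_proper_filter, HF|].
  intros e; destruct (HC e) as [z Hz]; exists (snd z).
  apply filter_imp with (2 := Hz); intros w [_ Hw]; exact Hw. }
generalize (filter_and _ _ H1 H2); apply filter_imp; intros z Hz; exact Hz.
Qed.

Lemma prod_close_lim (F G : (prod_UniformSpace U V -> Prop) -> Prop) :
  filter_le F G -> filter_le G F -> close (prod_lim F) (prod_lim G).
Proof.
intros HFG HGF eps; split.
- apply (close_lim (filtermap fst F) (filtermap fst G)); intros P HP;
    [apply HFG|apply HGF]; exact HP.
- apply (close_lim (filtermap snd F) (filtermap snd G)); intros P HP;
    [apply HFG|apply HGF]; exact HP.
Qed.

Definition prod_CompleteSpace_mixin :=
  CompleteSpace.Mixin (prod_UniformSpace U V) prod_lim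
    prod_complete_cauchy prod_close_lim.
End ProductComplete.

Definition prod_CompleteNormedModule (K : AbsRing) (U V : CompleteNormedModule K) :
  CompleteNormedModule K :=
  CompleteNormedModule.Pack K (U * V)
    (CompleteNormedModule.Class K (U * V)
       (NormedModule.class K (prod_NormedModule K U V))
       (prod_CompleteSpace_mixin U V))
    (U * V).

Section Lipschitz.
Context {V : NormedModule R_AbsRing}.
Variable D : V -> Prop.

(** Boundedness is carried along because products of merely Lipschitz
    functions need not be Lipschitz; with it the class is a ring that contains
    every polynomial in the coordinates, on any ball. *)
Definition bounded_lipschitz (f : V -> R) : Prop :=
  exists M L, 0 <= M /\ 0 <= L /\ (forall x, D x -> Rabs (f x) <= M) /\
    forall x y, D x -> D y -> Rabs (f x - f y) <= L * ndist x y.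

Lemma bounded_lipschitz_const (c : R) : bounded_lipschitz (fun _ => c).
Proof.
exists (Rabs c), 0; repeat split; [apply Rabs_pos|lra|intros; lra|].
intros x y _ _; rewrite Rminus_diag, Rabs_R0; lra.
Qed.

Lemma bounded_lipschitz_plus (f g : V -> R) :
  bounded_lipschitz f -> bounded_lipschitz g -> bounded_lipschitz (fun x => f x + g x).
Proof.
intros (M & L & HM & HL & Hf & Hf') (N & K & HN & HK & Hg & Hg').
exists (M + N), (L + K); repeat split; [lra|lra| |].
- intros x Hx; pose proof (Rabs_triang (f x) (g x)).
  specialize (Hf x Hx); specialize (Hg x Hx); lra.
- intros x y Hx Hy; specialize (Hf' x y Hx Hy); specialize (Hg' x y Hx Hy).
  replace (f x + g x - (f y + g y)) with (f x - f y + (g x - g y)) by ring.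
  pose proof (Rabs_triang (f x - f y) (g x - g y)); lra.
Qed.

Lemma bounded_lipschitz_mult (f g : V -> R) :
  bounded_lipschitz f -> bounded_lipschitz g -> bounded_lipschitz (fun x => f x * g x).
Proof.
intros (M & L & HM & HL & Hf & Hf') (N & K & HN & HK & Hg & Hg').
exists (M * N), (M * K + N * L); repeat split; [nra|nra| |].
- intros x Hx; rewrite Rabs_mult; apply Rmult_le_compat; auto using Rabs_pos.
- intros x y Hx Hy.
  replace (f x * g x - f y * g y) with (f x * (g x - g y) + g y * (f x - f y)) by ring.
  apply Rle_trans with (1 := Rabs_triang _ _); rewrite !Rabs_mult.
  assert (Rabs (f x) * Rabs (g x - g y) <= M * (K * ndist x y))
    by (apply Rmult_le_compat; auto using Rabs_pos).
  assert (Rabs (g y) * Rabs (f x - f y) <= N * (L * ndist x y))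
    by (apply Rmult_le_compat; auto using Rabs_pos).
  lra.
Qed.

Lemma bounded_lipschitz_opp (f : V -> R) :
  bounded_lipschitz f -> bounded_lipschitz (fun x => - f x).
Proof.
intros (M & L & HM & HL & Hf & Hf').
exists M, L; repeat split; auto.
- intros x Hx; rewrite Rabs_Ropp; auto.
- intros x y Hx Hy; replace (- f x - - f y) with (- (f x - f y)) by ring.
  rewrite Rabs_Ropp; auto.
Qed.

Lemma bounded_lipschitz_minus (f g : V -> R) :
  bounded_lipschitz f -> bounded_lipschitz g -> bounded_lipschitz (fun x => f x - g x).
Proof.
intros Hf Hg; apply bounded_lipschitz_plus; [exact Hf|apply bounded_lipschitz_opp, Hg].
Qed.

Lemma bounded_lipschitz_pow (f : V -> R) (k : nat) :
  bounded_lipschitz f -> bounded_lipschitz (fun x => f x ^ k).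
Proof.
intros Hf; induction k as [|k IH]; simpl.
- apply bounded_lipschitz_const.
- apply bounded_lipschitz_mult; assumption.
Qed.
End Lipschitz.

Lemma bounded_lipschitz_linear {V : NormedModule R_AbsRing} (f : V -> R)
    (p : V) (r : R) :
  is_linear (V := R_NormedModule) f -> bounded_lipschitz (fun x => ndist x p <= r) f.
Proof.
intros Hf; destruct (linear_norm f Hf) as [L [HL HfL]].
assert (Hlip : forall x y, Rabs (f x - f y) <= L * ndist x y).
{ intros x y; apply Rle_trans with (2 := HfL (minus x y)).
  rewrite (linear_minus (V := R_NormedModule) f x y Hf); apply Rle_refl. }
exists (Rabs (f p) + L * Rabs r), L; repeat split; [|lra| |].
- pose proof (Rabs_pos (f p)); pose proof (Rabs_pos r); nra.
- intros x Hx; specialize (Hlip x p).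
  pose proof (Rabs_triang (f p) (f x - f p)) as H.
  replace (f p + (f x - f p)) with (f x) in H by ring.
  pose proof (Rle_abs r); nra.
- intros x y _ _; apply Hlip.
Qed.

Lemma bounded_lipschitz_continuous {V : NormedModule R_AbsRing} (f : V -> R) (x : V) :
  bounded_lipschitz (fun y => ndist y x <= 1) f -> continuous f x.
Proof.
intros (M & L & _ & HL & _ & Hf).
apply (continuous_ndist (V := R_NormedModule)); intros eps Heps.
assert (Hd : 0 < Rmin 1 (eps / (L + 1))).
{ apply Rmin_pos; [lra|apply Rdiv_lt_0_compat; lra]. }
apply locally_le_locally_norm; exists (mkposreal _ Hd); intros y Hy.
change (ndist y x < Rmin 1 (eps / (L + 1))) in Hy.
pose proof (Rmin_l 1 (eps / (L + 1))); pose proof (Rmin_r 1 (eps / (L + 1))).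
change (Rabs (f y - f x) < eps).
apply Rle_lt_trans with (L * ndist y x).
{ apply Hf; [lra|rewrite ndist_refl; lra]. }
assert (ndist y x * (L + 1) < eps) by (apply Rlt_div_r; lra).
pose proof (ndist_ge_0 y x); nra.
Qed.

Lemma is_derive_linear {U V : NormedModule R_AbsRing} (f : U -> V) (phi : R -> U)
    (t : R) (v : U) :
  is_linear f -> is_derive phi t v -> is_derive (fun s => f (phi s)) t (f v).
Proof.
intros Hf Hphi.
apply filterdiff_ext_lin with (fun y => f (scal y v)).
- apply (filterdiff_comp' phi f); [exact Hphi|apply filterdiff_linear, Hf].
- intros y; apply (linear_scal f Hf).
Qed.

Lemma is_derive_square (f : R -> R) (t d c : R) :
  is_derive f t d -> is_derive (fun s => (f s - c) ^ 2) t (2 * d * (f t - c)).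
Proof.
intros H; auto_derive; [eexists; exact H|].
replace (Derive (fun x => f x) t) with d by (symmetry; apply is_derive_unique, H).
ring.
Qed.

Lemma is_derive_weighted_sum (f g : R -> R) (t df dg a b : R) :
  is_derive f t df -> is_derive g t dg ->
  is_derive (fun s => a * f s + b * g s) t (a * df + b * dg).
Proof.
intros Hf Hg; auto_derive; [split; [eexists; exact Hf|split; [eexists; exact Hg|auto]]|].
replace (Derive (fun x => f x) t) with df by (symmetry; apply is_derive_unique, Hf).
replace (Derive (fun x => g x) t) with dg by (symmetry; apply is_derive_unique, Hg).
ring.
Qed.

Lemma ndist_prod {U V : NormedModule R_AbsRing} (z w : prod_NormedModule R_AbsRing U V) :
  ndist z w ^ 2 = ndist (fst z) (fst w) ^ 2 + ndist (snd z) (snd w) ^ 2.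
Proof.
apply pow2_sqrt; apply Rplus_le_le_0_compat; apply pow2_ge_0.
Qed.

Lemma ndist_R (x y : R_NormedModule) : ndist x y ^ 2 = (x - y) ^ 2.
Proof. apply pow2_abs. Qed.

(** * Global solutions for Lipschitz vector fields *)

Section Picard.
Context {V : CompleteNormedModule R_AbsRing}.
Variables (G : V -> V) (L : R).
Hypothesis L_pos : 0 < L.
Hypothesis G_lip : forall x y, ndist (G x) (G y) <= L * ndist x y.
Variable x0 : V.

(** In the norm sup |f t| / weight t the Picard operator contracts by the
    factor 1/2 on the whole line at once, so that solutions are obtained
    globally, without gluing local ones.  Both exponentials are there to treat
    positive and negative times alike. *)
Definition weight (t : R) : R := exp (2 * L * t) + exp (- (2 * L * t)).

Lemma weight_ge_1 (t : R) : 1 <= weight t.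
Proof.
unfold weight.
pose proof (exp_ineq1_le (2 * L * t)); pose proof (exp_ineq1_le (- (2 * L * t))).
lra.
Qed.

Lemma weight_continuous (t : R) : continuous weight t.
Proof.
apply (ex_derive_continuous (K := R_AbsRing) (V := R_NormedModule)).
unfold weight; auto_derive; auto.
Qed.

Definition picard (f : R -> V) (t : R) : V :=
  plus x0 (RInt (fun s => G (f s)) 0 t).

Lemma Gf_continuous (f : R -> V) :
  (forall t, continuous f t) -> forall t, continuous (fun s => G (f s)) t.
Proof.
intros Hf t; apply continuous_comp; [apply Hf|].
apply (lipschitz_continuous G L G_lip).
Qed.

Lemma picard_derive (f : R -> V) :
  (forall t, continuous f t) -> forall t, is_derive (picard f) t (G (f t)).
Proof.
intros Hf t.
replace (G (f t)) with (plus zero (G (f t))) by apply plus_zero_l.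
apply (is_derive_plus (fun _ => x0) (fun t => RInt (fun s => G (f s)) 0 t)).
- apply (is_derive_const (K := R_AbsRing) (V := V)).
- apply (is_derive_RInt (fun s => G (f s)) _ 0 t).
  + apply filter_forall; intros b; apply RInt_correct.
    apply ex_RInt_continuous; intros z _; now apply Gf_continuous.
  + now apply Gf_continuous.
Qed.

(** The integral of weight from 0 to t is a difference of the two exponentials
    divided by 2 L, so integration gains the factor 1 / (2 L). *)
Lemma norm_RInt_weight (f : R -> V) (c t : R) :
  (forall s, continuous f s) ->
  (forall s, norm (f s) <= c * weight s) ->
  norm (RInt f 0 t) <= c / (2 * L) * weight t.
Proof.
intros Hf Hc.
assert (Hc0 : 0 <= c).
{ pose proof (weight_ge_1 0); pose proof (norm_ge_0 (f 0)); specialize (Hc 0); nra. }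
assert (Hq : 0 <= c / (2 * L)) by (apply Rdiv_le_0_compat; lra).
set (S := fun s => c / (2 * L) * (exp (2 * L * s) - exp (- (2 * L * s)))).
assert (HS : forall a b, is_RInt (fun s => c * weight s) a b (S b - S a)).
{ intros a b; apply (is_RInt_derive S).
  - intros x _; unfold S, weight; auto_derive; [auto|]; field; lra.
  - intros x _; apply (continuous_scal_r (V := R_NormedModule)).
    apply weight_continuous. }
assert (HI : forall a b, is_RInt f a b (RInt f a b)).
{ intros a b; apply RInt_correct, ex_RInt_continuous; intros z _; apply Hf. }
assert (HS0 : S 0 = 0).
{ unfold S; rewrite Rmult_0_r, Ropp_0; ring. }
pose proof (exp_pos (2 * L * t)); pose proof (exp_pos (- (2 * L * t))).
destruct (Rle_dec 0 t) as [Ht|Ht].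
- apply Rle_trans with (S t - S 0).
  + apply (norm_RInt_le f (fun s => c * weight s) 0 t); auto.
  + rewrite HS0; unfold S, weight; nra.
- apply Rle_trans with (norm (RInt f t 0)).
  { rewrite <- (opp_RInt_swap f t 0)
      by (apply ex_RInt_continuous; intros z _; apply Hf).
    apply Req_le, (norm_opp (V := V)). }
  apply Rle_trans with (S 0 - S t).
  + apply (norm_RInt_le f (fun s => c * weight s) t 0); auto; lra.
  + rewrite HS0; unfold S, weight; nra.
Qed.

Lemma picard_contraction (f g : R -> V) (c : R) :
  (forall t, continuous f t) -> (forall t, continuous g t) ->
  (forall t, ndist (f t) (g t) <= c * weight t) ->
  forall t, ndist (picard f t) (picard g t) <= c / 2 * weight t.
Proof.
intros Hf Hg Hc t; unfold picard.
set (D := fun s => minus (G (f s)) (G (g s))).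
assert (E : RInt D 0 t
            = minus (RInt (fun s => G (f s)) 0 t) (RInt (fun s => G (g s)) 0 t)).
{ apply (RInt_minus (V := V));
    apply ex_RInt_continuous; intros z _; now apply Gf_continuous. }
apply Rle_trans with (norm (RInt D 0 t)).
{ rewrite E; apply Req_le, (ndist_plus_l (V := V)). }
replace (c / 2) with (L * c / (2 * L)) by (field; lra).
apply norm_RInt_weight.
- intros s; apply (continuous_minus (V := V)); now apply Gf_continuous.
- intros s; apply Rle_trans with (1 := G_lip _ _).
  rewrite Rmult_assoc; apply Rmult_le_compat_l; [lra|apply Hc].
Qed.

Fixpoint iterate (k : nat) : R -> V :=
  match k with O => fun _ => x0 | S k => picard (iterate k) end.

Lemma iterate_continuous (k : nat) : forall t, continuous (iterate k) t.
Proof.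
induction k as [|k IH]; intros t; simpl.
- apply continuous_const.
- apply (ex_derive_continuous (K := R_AbsRing) (V := V)).
  eexists; apply picard_derive, IH.
Qed.

(** The distances of consecutive iterates form a geometric series. *)
Lemma iterate_close : exists C, 0 <= C /\ forall k j t,
  ndist (iterate (k + j) t) (iterate k t) <= C * (/ 2) ^ k * weight t.
Proof.
set (c := norm (G x0) / (2 * L)).
assert (Hc : 0 <= c) by (apply Rdiv_le_0_compat; [apply norm_ge_0|lra]).
assert (H1 : forall k t, ndist (iterate (S k) t) (iterate k t)
                         <= c * (/ 2) ^ k * weight t).
{ induction k as [|k IH]; intros t.
  - simpl; unfold picard.
    replace (ndist _ _) with (norm (RInt (fun _ : R => G x0) 0 t)).
    + rewrite Rmult_1_r; apply norm_RInt_weight.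
      * intros s; apply continuous_const.
      * intros s; pose proof (weight_ge_1 s); pose proof (norm_ge_0 (G x0)); nra.
    + symmetry; exact (f_equal norm (plus_minus_l (G := V) x0 _)).
  - apply Rle_trans with (c * (/ 2) ^ k / 2 * weight t).
    + apply (picard_contraction (iterate (S k)) (iterate k)); auto;
        apply iterate_continuous.
    + simpl; lra. }
exists (2 * c); split; [lra|].
intros k j t.
pose proof (weight_ge_1 t) as Hw.
assert (Hk : forall m, 0 < (/ 2) ^ m) by (intros m; apply pow_lt; lra).
assert (ndist (iterate (k + j) t) (iterate k t)
        <= 2 * c * ((/ 2) ^ k - (/ 2) ^ (k + j)) * weight t) as H2.
{ induction j as [|j IH].
  - rewrite Nat.add_0_r; rewrite ndist_refl; lra.
  - rewrite Nat.add_succ_r.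
    apply Rle_trans with (1 := ndist_triangle _ (iterate (k + j) t) _).
    specialize (H1 (k + j)%nat t).
    change ((/ 2) ^ S (k + j)) with (/ 2 * (/ 2) ^ (k + j)).
    nra. }
apply Rle_trans with (1 := H2).
apply Rmult_le_compat_r; [lra|].
apply Rmult_le_compat_l; [lra|].
specialize (Hk (k + j)%nat); lra.
Qed.

Lemma half_pow_small (C eps : R) :
  0 <= C -> 0 < eps -> exists k, C * (/ 2) ^ k < eps.
Proof.
intros HC He.
destruct (pow_lt_1_zero (/ 2)) with (y := eps / (C + 1)) as [k Hk].
- rewrite Rabs_pos_eq; lra.
- apply Rdiv_lt_0_compat; lra.
- exists k.
  specialize (Hk k (le_n k)).
  assert (0 < (/ 2) ^ k) by (apply pow_lt; lra).
  rewrite Rabs_pos_eq in Hk by lra.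
  apply Rle_lt_trans with ((C + 1) * (/ 2) ^ k); [nra|].
  apply Rmult_lt_reg_r with (/ (C + 1)); [apply Rinv_0_lt_compat; lra|].
  replace ((C + 1) * (/ 2) ^ k * / (C + 1)) with ((/ 2) ^ k) by (field; lra).
  exact Hk.
Qed.

(** The iterates converge pointwise by completeness.  The geometric bound is
    locally uniform in t, which makes the limit continuous, and passing to the
    limit in the contraction estimate shows that it is a fixed point of the
    Picard operator, hence a solution. *)
Theorem picard_lindelof :
  exists phi : R -> V, phi 0 = x0 /\ forall t, is_derive phi t (G (phi t)).
Proof.
destruct iterate_close as [C [HC Hit]].
assert (Hlim : forall t, exists v, filterlim (fun k => iterate k t) eventually (locally v)).
{ intros t.
  apply (filterlim_locally_cauchy (U := V) (F := eventually)); intros eps.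
  pose proof (weight_ge_1 t) as Hw.
  destruct (half_pow_small (2 * C * weight t) eps) as [k Hk];
    [nra|apply cond_pos|].
  exists (fun m => (k <= m)%nat); split; [exists k; auto|].
  intros m n Hm Hn; apply (norm_compat1 (V := V)).
  change (ndist (iterate n t) (iterate m t) < eps).
  apply Rle_lt_trans with (1 := ndist_triangle _ (iterate k t) _).
  rewrite (ndist_sym (iterate k t)).
  pose proof (Hit k (m - k)%nat t) as Hm'; pose proof (Hit k (n - k)%nat t) as Hn'.
  replace (k + (m - k))%nat with m in Hm' by lia.
  replace (k + (n - k))%nat with n in Hn' by lia.
  lra. }
set (phi := fun t => proj1_sig (constructive_indefinite_description _ (Hlim t))).
assert (Hphi : forall t, filterlim (fun k => iterate k t) eventually (locally (phi t))).
{ intros t; unfold phi; destruct constructive_indefinite_description; assumption. }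
assert (Hclose : forall k t, ndist (phi t) (iterate k t) <= C * (/ 2) ^ k * weight t).
{ intros k t; apply le_epsilon; intros eps Heps.
  pose proof (proj1 (filterlim_locally_norm _ _) (Hphi t) eps Heps) as [m Hm].
  specialize (Hm (k + m)%nat ltac:(lia)).
  apply Rle_trans with (1 := ndist_triangle _ (iterate (k + m) t) _).
  rewrite (ndist_sym (phi t)).
  specialize (Hit k m t); lra. }
assert (Hcont : forall t, continuous phi t).
{ intros t; apply (continuous_ndist (V := V)); intros eps Heps.
  pose proof (weight_ge_1 t) as Hw.
  destruct (half_pow_small (C * (2 * weight t + 1)) (eps / 2)) as [k Hk]; [nra|lra|].
  assert (Hpk : 0 < (/ 2) ^ k) by (apply pow_lt; lra).
  generalize (filter_and (F := locally t) _ _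
    (proj1 (continuous_ndist (V := V) _ _) (iterate_continuous k t) (eps / 2) ltac:(lra))
    (proj1 (continuous_ndist (V := R_NormedModule) _ _)
       (weight_continuous t) 1 ltac:(lra))).
  apply filter_imp; intros s [H1 H2].
  assert (Hws : weight s < weight t + 1).
  { apply Rabs_def2 in H2; unfold minus, plus, opp in H2; simpl in H2; lra. }
  apply Rle_lt_trans with (1 := ndist_triangle _ (iterate k s) _).
  pose proof (ndist_triangle (iterate k s) (iterate k t) (phi t)) as H3.
  rewrite (ndist_sym (iterate k t)) in H3.
  pose proof (Hclose k s) as H4; pose proof (Hclose k t) as H5.
  assert (C * (/ 2) ^ k * weight s <= C * (/ 2) ^ k * (weight t + 1))
    by (apply Rmult_le_compat_l; [apply Rmult_le_pos|]; lra).
  nra. }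
assert (Hfix : forall t, picard phi t = phi t).
{ intros t.
  assert (Hn : ndist (picard phi t) (phi t) <= 0).
  { apply le_epsilon; intros eps Heps.
    pose proof (weight_ge_1 t) as Hw.
    destruct (half_pow_small (C * weight t) eps) as [k Hk]; [nra|lra|].
    apply Rle_trans with (1 := ndist_triangle _ (iterate (S k) t) _).
    rewrite (ndist_sym (iterate (S k) t)).
    pose proof (Hclose (S k) t) as H1; simpl pow in H1.
    pose proof (picard_contraction phi (iterate k) _ Hcont (iterate_continuous k)
      (Hclose k) t) as H2.
    change (picard (iterate k)) with (iterate (S k)) in H2.
    lra. }
  now apply ndist_eq_0. }
exists phi; split.
- rewrite <- Hfix; unfold picard; rewrite RInt_point; apply plus_zero_r.
- intros t; apply is_derive_ext with (picard phi); [exact Hfix|].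
  now apply picard_derive.
Qed.
End Picard.

(** * Localising a vector field *)

(** The radial retraction onto the closed ball of centre p and radius r.
    Composing a field with it makes the field globally Lipschitz without
    changing it inside the ball. *)
Definition retract {V : NormedModule R_AbsRing} (p : V) (r : R) (x : V) : V :=
  plus p (scal (r / Rmax r (ndist x p)) (minus x p)).

Lemma Rmax_lipschitz (r a b : R) : Rabs (Rmax r a - Rmax r b) <= Rabs (a - b).
Proof.
unfold Rmax; destruct (Rle_dec r a); destruct (Rle_dec r b);
  unfold Rabs; repeat destruct Rcase_abs; lra.
Qed.

Section Retract.
Context {V : NormedModule R_AbsRing}.
Variables (p : V) (r : R).
Hypothesis r_pos : 0 < r.

Lemma retract_id (x : V) : ndist x p <= r -> retract p r x = x.
Proof.
intros Hx; unfold retract; rewrite Rmax_left by exact Hx.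
replace (r / r) with (one : R_AbsRing) by (change (1 = r / r); field; lra).
rewrite scal_one; exact (plus_minus_r (G := NormedModule.AbelianGroup _ V) p x).
Qed.

Lemma norm_scal_R (k : R) (x : V) : norm (scal k x) <= Rabs k * norm x.
Proof. exact (norm_scal k x). Qed.

Lemma retract_ball (x : V) : ndist (retract p r x) p <= r.
Proof.
unfold retract.
set (m := Rmax r (ndist x p)).
assert (Hm : r <= m) by apply Rmax_l.
assert (Hm' : ndist x p <= m) by apply Rmax_r.
assert (Hq : 0 < r / m) by (apply Rdiv_lt_0_compat; lra).
apply Rle_trans with (norm (scal (r / m) (minus x p))).
{ apply Req_le; exact (f_equal norm (plus_minus_l (G := NormedModule.AbelianGroup _ V) p _)). }
apply Rle_trans with (1 := norm_scal_R _ _).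
change (norm (minus x p)) with (ndist x p).
rewrite Rabs_pos_eq by lra.
apply Rle_trans with (r / m * m); [apply Rmult_le_compat_l; lra|].
apply Req_le; field; lra.
Qed.

(** With m = max(r, |x - p|) and n = max(r, |y - p|) the difference of the two
    images is (r / m) (x - y) + (r / m - r / n) (y - p).  The first term has norm
    at most |x - y| since r <= m; so has the second one, of norm
    r |n - m| |y - p| / (m n), since |y - p| <= n and |n - m| <= |x - y|. *)
Lemma retract_lipschitz (x y : V) :
  ndist (retract p r x) (retract p r y) <= 2 * ndist x y.
Proof.
unfold retract.
set (m := Rmax r (ndist x p)); set (n := Rmax r (ndist y p)).
assert (Hm : r <= m) by apply Rmax_l.
assert (Hn : r <= n) by apply Rmax_l.
assert (Hn' : ndist y p <= n) by apply Rmax_r.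
assert (Hmn : Rabs (n - m) <= ndist x y).
{ apply Rle_trans with (1 := Rmax_lipschitz r (ndist y p) (ndist x p)).
  pose proof (ndist_triangle x y p); pose proof (ndist_triangle y x p) as H'.
  rewrite (ndist_sym y x) in H'.
  apply Rabs_le; lra. }
pose proof (ndist_ge_0 x y) as Hxy; pose proof (ndist_ge_0 y p) as Hyp.
rewrite ndist_plus_l.
apply Rle_trans with (1 := ndist_triangle _ (scal (r / m) (minus y p)) _).
assert (H1 : ndist (scal (r / m) (minus x p)) (scal (r / m) (minus y p)) <= ndist x y).
{ assert (Hq : 0 <= r / m <= 1).
  { split; [apply Rdiv_le_0_compat; lra|].
    apply Rmult_le_reg_r with m; [lra|]; unfold Rdiv.
    rewrite Rmult_assoc, Rinv_l; lra. }
  apply Rle_trans with (norm (scal (r / m) (minus x y))).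
  - rewrite (minus_trans p x y), <- (opp_minus y p).
    apply Req_le; symmetry.
    exact (f_equal norm (scal_minus_distr_l (r / m) (minus x p) (minus y p))).
  - apply Rle_trans with (1 := norm_scal_R _ _).
    change (norm (minus x y)) with (ndist x y).
    rewrite Rabs_pos_eq by lra; nra. }
assert (H2 : ndist (scal (r / m) (minus y p)) (scal (r / n) (minus y p)) <= ndist x y).
{ apply Rle_trans with (norm (scal (r / m - r / n) (minus y p))).
  - apply Req_le; symmetry.
    exact (f_equal norm (scal_minus_distr_r (r / m) (r / n) (minus y p))).
  - apply Rle_trans with (1 := norm_scal_R _ _).
    change (norm (minus y p)) with (ndist y p).
    replace (r / m - r / n) with ((n - m) * (r / (m * n))) by (field; lra).
    assert (Hq : 0 < r / (m * n)) by (apply Rdiv_lt_0_compat; nra).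
    rewrite Rabs_mult, (Rabs_pos_eq (r / (m * n))) by lra.
    assert (Hq1 : r / (m * n) * n <= 1).
    { replace (r / (m * n) * n) with (r / m) by (field; lra).
      apply Rmult_le_reg_r with m; [lra|]; unfold Rdiv.
      rewrite Rmult_assoc, Rinv_l; lra. }
    assert (r / (m * n) * ndist y p <= 1).
    { apply Rle_trans with (2 := Hq1); apply Rmult_le_compat_l; lra. }
    assert (0 <= r / (m * n) * ndist y p) by (apply Rmult_le_pos; lra).
    pose proof (Rabs_pos (n - m)).
    rewrite Rmult_assoc; nra. }
lra.
Qed.
End Retract.

(** * Differential inequalities and confinement *)

(** The derivative is only required inside the interval, since solutions
    need not be differentiable at time 0; hence the mean value theorem with interior
    intermediate point. *)
Lemma nondecreasing_of_derive (f : R -> R) (a b : R) :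
  a < b ->
  (forall t, a < t < b -> exists d, is_derive f t d /\ 0 <= d) ->
  (forall t, a <= t <= b -> continuous f t) ->
  f a <= f b.
Proof.
intros Hab Hd Hc.
assert (pr : forall c, a < c < b -> derivable_pt f c).
{ intros c Hcab; apply ex_derive_Reals_0.
  destruct (Hd c Hcab) as [d [H _]]; exists d; exact H. }
destruct (MVT f id a b pr (fun c _ => derivable_pt_id c)) as [c [P H]]; auto.
- intros c Hcab; apply continuity_pt_filterlim, Hc, Hcab.
- intros c _; apply derivable_continuous_pt, derivable_pt_id.
- rewrite derive_pt_id in H; unfold id in H.
  destruct (Hd c P) as [d [Hder Hpos]].
  assert (E : derive_pt f c (pr c P) = d).
  { apply derive_pt_eq_0, is_derive_Reals, Hder. }
  rewrite E in H; nra.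
Qed.

(** The function w t * exp (- c t) is nondecreasing.  With w replaced by its
    opposite this also yields exponential decay. *)
Lemma gronwall_growth (w : R -> R) (c T : R) :
  0 <= T ->
  (forall t, 0 < t < T -> exists d, is_derive w t d /\ c * w t <= d) ->
  (forall t, continuous w t) ->
  w 0 * exp (c * T) <= w T.
Proof.
intros HT Hd Hc.
destruct (Req_dec T 0) as [E|HT0].
{ rewrite E, Rmult_0_r, exp_0; lra. }
assert (H : w 0 * exp (- c * 0) <= w T * exp (- c * T)).
{ apply (nondecreasing_of_derive (fun t => w t * exp (- c * t))); [lra| |].
  - intros t Ht; destruct (Hd t Ht) as [d [Hder Hle]].
    exists (d * exp (- c * t) + w t * (- c * exp (- c * t))); split.
    + apply (is_derive_mult w (fun t => exp (- c * t))).
      * exact Hder.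
      * auto_derive; [auto|ring].
      * intros; apply Rmult_comm.
    + pose proof (exp_pos (- c * t)); nra.
  - intros t _; apply (continuous_mult w (fun t => exp (- c * t))); [apply Hc|].
    apply (ex_derive_continuous (K := R_AbsRing) (V := R_NormedModule)).
    auto_derive; auto. }
rewrite Rmult_0_r, exp_0, Rmult_1_r in H.
apply Rle_trans with (w T * exp (- c * T) * exp (c * T)).
- apply Rmult_le_compat_r; [left; apply exp_pos|exact H].
- rewrite Rmult_assoc, <- exp_plus.
  replace (- c * T + c * T) with 0 by ring; rewrite exp_0; lra.
Qed.

(** Continuous induction: a first time at which h reaches e would contradict
    the step hypothesis. *)
Lemma stays_below (h : R -> R) (e : R) :
  (forall t, continuous h t) -> h 0 < e ->
  (forall T, 0 < T -> (forall s, 0 <= s < T -> h s < e) -> h T < e) ->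
  forall t, 0 <= t -> h t < e.
Proof.
intros Hc H0 Hstep t1 Ht1.
destruct (Rlt_or_le (h t1) e) as [|Hbad]; [assumption|exfalso].
set (S := fun s => 0 <= s <= t1 /\ forall u, 0 <= u <= s -> h u < e).
destruct (completeness S) as [m [Hub Hlub]].
{ exists t1; intros s [Hs _]; lra. }
{ exists 0; split; [lra|]; intros u Hu; replace u with 0 by lra; exact H0. }
assert (Hm0 : 0 <= m).
{ apply Hub; split; [lra|]; intros u Hu; replace u with 0 by lra; exact H0. }
assert (Hmt : m <= t1) by (apply Hlub; intros s [Hs _]; lra).
assert (Hbelow : forall s, 0 <= s < m -> h s < e).
{ intros s Hs; apply NNPP; intros Hn.
  assert (m <= s); [|lra].
  apply Hlub; intros u [Hu1 Hu2].
  destruct (Rle_or_lt u s) as [|Hus]; [assumption|].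
  exfalso; apply Hn, Hu2; lra. }
assert (Hm : h m < e).
{ destruct (Req_dec m 0) as [E|]; [rewrite E; exact H0|].
  apply Hstep; [lra|exact Hbelow]. }
destruct (proj1 (continuous_ndist (V := R_NormedModule) h m) (Hc m) (e - h m))
  as [d Hd]; [lra|].
assert (Hnear : forall s, m <= s < m + d -> h s < e).
{ intros s Hs.
  assert (Hb : ball m d s).
  { change (Rabs (s - m) < d); rewrite Rabs_pos_eq; lra. }
  specialize (Hd s Hb); change (Rabs (h s - h m) < e - h m) in Hd.
  apply Rabs_def2 in Hd; lra. }
pose proof (cond_pos d) as Hdpos.
destruct (Rlt_or_le t1 (m + d)) as [Hlt|Hge].
- specialize (Hnear t1); lra.
- assert (Hin : S (m + d / 2)).
  { split; [lra|]; intros u Hu.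
    destruct (Rlt_or_le u m); [apply Hbelow|apply Hnear]; lra. }
  specialize (Hub _ Hin); lra.
Qed.

Section Trajectory.
Context {V : NormedModule R_AbsRing}.

(** Freezing a solution at its initial value for negative times turns
    right-continuity at 0 into continuity on the whole line. *)
Lemma continuous_clamp (phi : R -> V) :
  (forall t, 0 < t -> continuous phi t) ->
  filterlim phi (at_right 0) (locally (phi 0)) ->
  forall t, continuous (fun s => phi (Rmax 0 s)) t.
Proof.
intros Hpos H0 t.
destruct (Rtotal_order t 0) as [Ht|[Ht|Ht]].
- apply continuous_ext_loc with (fun _ => phi 0); [|apply continuous_const].
  apply filter_imp with (2 := open_lt 0 t Ht).
  intros s Hs; rewrite Rmax_left; [reflexivity|lra].
- subst t; apply continuous_ndist; intros eps Heps.
  rewrite (Rmax_left 0 0) by lra.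
  pose proof (proj1 (filterlim_locally_norm _ _) H0 eps Heps) as Hr.
  unfold at_right, within in Hr; revert Hr; apply filter_imp.
  intros s Hs; destruct (Rle_or_lt s 0) as [Hs0|Hs0].
  + rewrite Rmax_left by exact Hs0; rewrite ndist_refl; exact Heps.
  + rewrite Rmax_right by lra; exact (Hs Hs0).
- apply continuous_ext_loc with phi; [|apply Hpos, Ht].
  apply filter_imp with (2 := open_gt 0 t Ht).
  intros s Hs; rewrite Rmax_right; [reflexivity|lra].
Qed.

Lemma is_derive_continuous (phi : R -> V) (t : R) (v : V) :
  is_derive phi t v -> continuous phi t.
Proof.
intros H; apply (ex_derive_continuous (K := R_AbsRing) phi t); exists v; exact H.
Qed.

Lemma gronwall_along (W : V -> R) (phi : R -> V) (c T : R) :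
  0 <= T ->
  (forall x, continuous W x) ->
  (forall t, 0 < t -> continuous phi t) ->
  filterlim phi (at_right 0) (locally (phi 0)) ->
  (forall t, 0 < t < T ->
     exists d, is_derive (fun s => W (phi s)) t d /\ c * W (phi t) <= d) ->
  W (phi 0) * exp (c * T) <= W (phi T).
Proof.
intros HT HW Hphi H0 Hd.
pose proof (gronwall_growth (fun s => W (phi (Rmax 0 s))) c T HT) as H.
simpl in H; rewrite (Rmax_left 0 0), (Rmax_right 0 T) in H by lra.
apply H.
- intros t Ht; rewrite (Rmax_right 0 t) by lra.
  destruct (Hd t Ht) as [d [Hder Hle]]; exists d; split; [|exact Hle].
  apply is_derive_ext_loc with (2 := Hder).
  apply filter_imp with (2 := open_gt 0 t (proj1 Ht)).
  intros s Hs; rewrite Rmax_right; [reflexivity|lra].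
- intros t; apply (continuous_comp (fun s => phi (Rmax 0 s)) W); [|apply HW].
  apply continuous_clamp; assumption.
Qed.

(** * Instability from an exponentially growing function *)

(** A trajectory starting close to p with W positive cannot stay in the ball:
    there W would grow exponentially while being bounded. *)
Theorem instability (F : V -> V) (p : V) (W : V -> R) (r m M : R) :
  0 < r -> 0 < m ->
  (forall x, continuous W x) ->
  (forall x, ndist x p < r -> W x <= M) ->
  (forall (phi : R -> V) t, is_derive phi t (F (phi t)) -> ndist (phi t) p < r ->
     exists d, is_derive (fun s => W (phi s)) t d /\ m * W (phi t) <= d) ->
  (forall d, 0 < d -> exists x0, ndist x0 p < d /\ 0 < W x0) ->
  unstable F p.
Proof.
intros Hr Hm HW HM Hgrow Hstart Hstab.
destruct (Hstab r Hr) as [d [Hd Hx]].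
destruct (Hstart d Hd) as [x0 [Hx0 HW0]].
destruct (Hx x0 Hx0) as [[phi [[Hsol H0] Hphi0]] Hin].
specialize (Hin phi (conj Hsol H0) Hphi0).
set (T := Rabs M / (m * W x0)).
assert (HT : 0 <= T).
{ apply Rdiv_le_0_compat; [apply Rabs_pos|apply Rmult_lt_0_compat; assumption]. }
assert (H : W (phi 0) * exp (m * T) <= W (phi T)).
{ apply gronwall_along; auto.
  - intros t Ht; apply is_derive_continuous with (1 := Hsol t Ht).
  - intros t Ht; apply Hgrow; [apply Hsol|apply Hin]; lra. }
specialize (HM (phi T) (Hin T HT)).
pose proof (exp_ineq1_le (m * T)) as He.
rewrite Hphi0 in H.
assert (W x0 * (1 + m * T) = W x0 + Rabs M) by (unfold T; field; lra).
pose proof (Rle_abs M); nra.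
Qed.
End Trajectory.

(** * Lyapunov's direct method *)

Section DirectMethod.
Context {V : CompleteNormedModule R_AbsRing}.
Variables (F : V -> V) (p : V) (W : V -> R) (r c1 c2 c L : R).
Hypothesis r_pos : 0 < r.
Hypothesis c1_pos : 0 < c1.
Hypothesis c2_pos : 0 < c2.
Hypothesis c_pos : 0 < c.
Hypothesis L_pos : 0 < L.
Hypothesis F_lip : forall x y, ndist x p <= r -> ndist y p <= r ->
  ndist (F x) (F y) <= L * ndist x y.
Hypothesis W_cont : forall x, continuous W x.
Hypothesis W_low : forall x, c1 * ndist x p ^ 2 <= W x.
Hypothesis W_up : forall x, W x <= c2 * ndist x p ^ 2.
Hypothesis W_decay : forall (phi : R -> V) t,
  is_derive phi t (F (phi t)) -> ndist (phi t) p < r ->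
  exists d, is_derive (fun s => W (phi s)) t d /\ d <= - c * W (phi t).

Lemma decay (phi : R -> V) (T : R) :
  0 <= T ->
  (forall t, 0 < t -> continuous phi t) ->
  filterlim phi (at_right 0) (locally (phi 0)) ->
  (forall t, 0 < t < T -> is_derive phi t (F (phi t)) /\ ndist (phi t) p < r) ->
  W (phi T) <= W (phi 0) * exp (- c * T).
Proof.
intros HT Hc H0 Hsol.
assert (H : - W (phi 0) * exp (- c * T) <= - W (phi T)).
{ apply (gronwall_along (V := V) (fun x => - W x)); auto.
  - intros x; apply (continuous_opp (V := R_NormedModule)), W_cont.
  - intros t Ht; destruct (Hsol t Ht) as [Hd Hb].
    destruct (W_decay phi t Hd Hb) as [d [Hder Hle]].
    exists (- d); split; [|lra].
    apply (is_derive_opp (K := R_AbsRing) (V := R_NormedModule)), Hder. }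
lra.
Qed.

(** As long as the trajectory stays in the ball of radius r, the function W
    decreases, so that it remains below its value on the sphere of radius eps.
    Differentiability is only assumed inside the ball of radius r: the lemma
    applies to solutions of F and to those of a field that agrees with F on
    that ball. *)
Lemma trapped (phi : R -> V) (eps : R) :
  0 < eps <= r ->
  (forall t, 0 < t -> continuous phi t) ->
  filterlim phi (at_right 0) (locally (phi 0)) ->
  (forall t, 0 < t -> ndist (phi t) p < r -> is_derive phi t (F (phi t))) ->
  c2 * ndist (phi 0) p ^ 2 < c1 * eps ^ 2 ->
  forall t, 0 <= t -> ndist (phi t) p < eps.
Proof.
intros Heps Hc H0 Hsol Hini.
assert (Hsmall : forall x, W x <= W (phi 0) -> ndist x p < eps).
{ intros x Hx; pose proof (W_low x); pose proof (W_up (phi 0)).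
  pose proof (ndist_ge_0 x p).
  apply Rnot_le_lt; intros Hge.
  assert (eps ^ 2 <= ndist x p ^ 2) by (apply pow_incr; lra).
  nra. }
intros t Ht.
pose proof (stays_below (fun s => ndist (phi (Rmax 0 s)) p) eps) as H.
rewrite <- (Rmax_right 0 t Ht).
apply H; auto; clear H.
- intros s; apply (continuous_ndist (V := R_NormedModule)); intros e He.
  pose proof (proj1 (continuous_ndist (V := V) _ _)
    (continuous_clamp (V := V) phi Hc H0 s) e He) as Hs.
  revert Hs; apply filter_imp; intros u Hu.
  apply Rle_lt_trans with (2 := Hu).
  change (Rabs (ndist (phi (Rmax 0 u)) p - ndist (phi (Rmax 0 s)) p)
          <= ndist (phi (Rmax 0 u)) (phi (Rmax 0 s))).
  pose proof (ndist_triangle (phi (Rmax 0 u)) (phi (Rmax 0 s)) p) as H1.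
  pose proof (ndist_triangle (phi (Rmax 0 s)) (phi (Rmax 0 u)) p) as H2.
  rewrite (ndist_sym (phi (Rmax 0 s)) (phi (Rmax 0 u))) in H2.
  apply Rabs_le; lra.
- rewrite (Rmax_left 0 0) by lra; apply Hsmall; lra.
- intros T HT Hbefore; rewrite (Rmax_right 0 T) by lra.
  assert (Hin : forall s, 0 < s < T -> ndist (phi s) p < r).
  { intros s Hs; specialize (Hbefore s ltac:(lra)).
    rewrite Rmax_right in Hbefore by lra; lra. }
  apply Hsmall.
  apply Rle_trans with (W (phi 0) * exp (- c * T)).
  + apply decay; auto; [lra|].
    intros s Hs; split; [apply Hsol; [lra|]|]; apply Hin; exact Hs.
  + assert (0 <= W (phi 0)).
    { pose proof (W_low (phi 0)); pose proof (pow2_ge_0 (ndist (phi 0) p)); nra. }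
    assert (exp (- c * T) <= 1).
    { rewrite <- exp_0; left; apply exp_increasing; nra. }
    nra.
Qed.

Lemma threshold (eps : R) : 0 < eps ->
  exists d, 0 < d /\ forall s, 0 <= s < d -> c2 * s ^ 2 < c1 * eps ^ 2.
Proof.
intros He.
assert (Hs : 0 < sqrt (c1 / c2)) by (apply sqrt_lt_R0, Rdiv_lt_0_compat; assumption).
exists (eps * sqrt (c1 / c2)); split; [nra|].
intros s Hs1.
assert (E : c1 * eps ^ 2 = c2 * (eps * sqrt (c1 / c2)) ^ 2).
{ rewrite Rpow_mult_distr, pow2_sqrt; [field; lra|].
  left; apply Rdiv_lt_0_compat; assumption. }
rewrite E; apply Rmult_lt_compat_l; [lra|]; nra.
Qed.

(** Solutions exist for all times because those of F composed with the
    retraction do, and they never leave the ball on which both fields agree.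
    Attractivity comes from the exponential decay of W along a trapped
    trajectory. *)
Theorem lyapunov_direct : asymptotically_stable F p.
Proof.
assert (Hsolc : forall phi, is_solution F phi -> forall t, 0 < t -> continuous phi t).
{ intros phi [Hsol _] t Ht; apply (is_derive_continuous (V := V)) with (1 := Hsol t Ht). }
split.
- intros eps Heps.
  set (e := Rmin eps r).
  assert (He : 0 < e <= r) by (split; [apply Rmin_pos|apply Rmin_r]; assumption).
  destruct (threshold e (proj1 He)) as [d [Hd Hth]].
  exists d; split; [exact Hd|]; intros x0 Hx0.
  change (ndist x0 p < d) in Hx0.
  assert (Hini : c2 * ndist x0 p ^ 2 < c1 * e ^ 2).
  { apply Hth; split; [apply ndist_ge_0|exact Hx0]. }
  split.
  + destruct (picard_lindelof (fun x => F (retract p r x)) (2 * L) ltac:(lra)) with x0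
      as [phi [Hphi0 Hphi]].
    { intros x y; apply Rle_trans with (L * ndist (retract p r x) (retract p r y)).
      - apply F_lip; now apply retract_ball.
      - pose proof (retract_lipschitz p r r_pos x y); nra. }
    assert (Hc : forall t, continuous phi t).
    { intros t; apply (is_derive_continuous (V := V)) with (1 := Hphi t). }
    assert (H0 : filterlim phi (at_right 0) (locally (phi 0))).
    { apply filterlim_filter_le_1 with (2 := Hc 0); apply filter_le_within. }
    assert (Hin : forall t, 0 <= t -> ndist (phi t) p < e).
    { apply trapped; auto.
      - intros t _ Hb; pose proof (Hphi t) as Hder.
        rewrite (retract_id p r r_pos (phi t)) in Hder by lra; exact Hder.
      - rewrite Hphi0; exact Hini. }
    exists phi; split; [split; [|exact H0]|exact Hphi0].
    intros t Ht; pose proof (Hphi t) as Hder; specialize (Hin t ltac:(lra)).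
    rewrite (retract_id p r r_pos (phi t)) in Hder by lra; exact Hder.
  + intros phi Hsol Hphi0 t Ht.
    apply Rlt_le_trans with e; [|apply Rmin_l].
    apply (trapped phi e He); auto.
    * apply Hsol.
    * intros s Hs _; apply Hsol, Hs.
    * rewrite Hphi0; exact Hini.
- destruct (threshold r r_pos) as [d [Hd Hth]].
  exists d; split; [exact Hd|]; intros phi Hsol Hphi0.
  change (ndist (phi 0) p < d) in Hphi0.
  assert (Hin : forall t, 0 <= t -> ndist (phi t) p < r).
  { apply trapped; auto; [lra|apply Hsol| |].
    - intros s Hs _; apply Hsol, Hs.
    - apply Hth; split; [apply ndist_ge_0|exact Hphi0]. }
  apply (filterlim_locally_norm (V := V)); intros eps Heps.
  assert (Hce : 0 < c1 * eps ^ 2) by (apply Rmult_lt_0_compat; [|apply pow_lt]; assumption).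
  pose proof (Rabs_pos (W (phi 0))) as HW0.
  exists ((Rabs (W (phi 0)) / (c1 * eps ^ 2)) / c); intros t Ht.
  assert (Hq : 0 <= Rabs (W (phi 0)) / (c1 * eps ^ 2)) by (apply Rdiv_le_0_compat; lra).
  assert (Ht0 : 0 < t).
  { apply Rle_lt_trans with (2 := Ht); apply Rdiv_le_0_compat; lra. }
  (* The bound on t was chosen so that exp (c t) >= 1 + c t beats the initial energy. *)
  assert (Hct : Rabs (W (phi 0)) < c1 * eps ^ 2 * exp (c * t)).
  { apply Rlt_le_trans with (c1 * eps ^ 2 * (c * t)).
    - apply Rmult_lt_reg_r with (/ (c1 * eps ^ 2) * / c).
      { apply Rmult_lt_0_compat; apply Rinv_0_lt_compat; lra. }
      replace (c1 * eps ^ 2 * (c * t) * (/ (c1 * eps ^ 2) * / c)) with t by (field; lra).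
      unfold Rdiv in Ht; lra.
    - pose proof (exp_ineq1_le (c * t)); nra. }
  assert (Hdec : W (phi t) <= W (phi 0) * exp (- c * t)).
  { apply decay; auto; [lra|apply Hsol|].
    intros s Hs; split; [apply Hsol|apply Hin]; lra. }
  assert (Hlt : W (phi t) < c1 * eps ^ 2).
  { apply Rle_lt_trans with (1 := Hdec).
    apply Rle_lt_trans with (Rabs (W (phi 0)) * exp (- c * t)).
    - apply Rmult_le_compat_r; [left; apply exp_pos|apply Rle_abs].
    - apply Rlt_le_trans with (c1 * eps ^ 2 * exp (c * t) * exp (- c * t)).
      + apply Rmult_lt_compat_r; [apply exp_pos|exact Hct].
      + rewrite Rmult_assoc, <- exp_plus.
        replace (c * t + - c * t) with 0 by ring; rewrite exp_0; lra. }
  pose proof (W_low (phi t)); pose proof (ndist_ge_0 (phi t) p).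
  apply Rnot_le_lt; intros Hge.
  assert (eps ^ 2 <= ndist (phi t) p ^ 2) by (apply pow_incr; lra).
  nra.
Qed.
End DirectMethod.

(** * The laser system in real coordinates *)

(** The underlying normed module is the state space of the laser system. *)
Definition complete_state : CompleteNormedModule R_AbsRing :=
  prod_CompleteNormedModule R_AbsRing
    (prod_CompleteNormedModule R_AbsRing C_R_CompleteNormedModule C_R_CompleteNormedModule)
    (prod_CompleteNormedModule R_AbsRing R_CompleteNormedModule R_CompleteNormedModule).

Lemma Cmod_pow2 (z : C) : Cmod z ^ 2 = fst z ^ 2 + snd z ^ 2.
Proof.
unfold Cmod; rewrite pow2_sqrt; [reflexivity|].
pose proof (pow2_ge_0 (fst z)); pose proof (pow2_ge_0 (snd z)); lra.
Qed.

Definition Em_re (s : state) : R := fst (fst (fst s)).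
Definition Em_im (s : state) : R := snd (fst (fst s)).
Definition Ep_re (s : state) : R := fst (snd (fst s)).
Definition Ep_im (s : state) : R := snd (snd (fst s)).
Definition carrier (s : state) : R := fst (snd s).
Definition spin (s : state) : R := snd (snd s).

(** The diagonal entries of X(N, n), which govern E_- and E_+ respectively. *)
Definition gain_m (s : state) : R := 1 - carrier s + spin s.
Definition gain_p (s : state) : R := 1 - carrier s - spin s.

(** The carrier equations are grouped by N - n and N + n, the factors of the two
    intensities.  In this form the cross terms in the derivative of the energy
    cancel. *)
Definition laser_field (kappa gamma delta mu : R) (u : C * C) (s : state) : state :=
  let I1 := (Em_re s ^ 2 + Em_im s ^ 2) * (carrier s - spin s) in
  let I2 := (Ep_re s ^ 2 + Ep_im s ^ 2) * (carrier s + spin s) in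
  (((- kappa * (gain_m s * Em_re s - fst (fst u)),
     - kappa * (gain_m s * Em_im s - snd (fst u))),
    (- kappa * (gain_p s * Ep_re s - fst (snd u)),
     - kappa * (gain_p s * Ep_im s - snd (snd u)))),
   (- gamma * (carrier s + I1 + I2 - mu), - gamma * (delta * spin s + I2 - I1))).

Lemma rhs_laser_field (kappa gamma delta mu : R) (u : C * C) (s : state) :
  rhs kappa gamma delta mu 0 u s = laser_field kappa gamma delta mu u s.
Proof.
destruct s as [[[x1 y1] [x2 y2]] [N n]]; destruct u as [[u1 v1] [u2 v2]].
unfold rhs, rhs_N, Y; rewrite !Cmod_pow2.
cbv -[Rplus Rmult Ropp Rminus IZR pow].
repeat (apply f_equal2); ring.
Qed.

Lemma is_linear_Em_re : is_linear (V := R_NormedModule) Em_re.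
Proof.
apply (is_linear_comp (fun s : state => fst (fst s)) fst);
  [apply (is_linear_comp fst fst); [apply is_linear_fst|apply is_linear_fst]
  |apply is_linear_fst].
Qed.

Lemma is_linear_Em_im : is_linear (V := R_NormedModule) Em_im.
Proof.
apply (is_linear_comp (fun s : state => fst (fst s)) snd);
  [apply (is_linear_comp fst fst); [apply is_linear_fst|apply is_linear_fst]
  |apply is_linear_snd].
Qed.

Lemma is_linear_Ep_re : is_linear (V := R_NormedModule) Ep_re.
Proof.
apply (is_linear_comp (fun s : state => snd (fst s)) fst);
  [apply (is_linear_comp fst snd); [apply is_linear_fst|apply is_linear_snd]
  |apply is_linear_fst].
Qed.

Lemma is_linear_Ep_im : is_linear (V := R_NormedModule) Ep_im.
Proof.
apply (is_linear_comp (fun s : state => snd (fst s)) snd);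
  [apply (is_linear_comp fst snd); [apply is_linear_fst|apply is_linear_snd]
  |apply is_linear_snd].
Qed.

Lemma is_linear_carrier : is_linear (V := R_NormedModule) carrier.
Proof.
apply (is_linear_comp snd fst); [apply is_linear_snd|apply is_linear_fst].
Qed.

Lemma is_linear_spin : is_linear (V := R_NormedModule) spin.
Proof.
apply (is_linear_comp snd snd); [apply is_linear_snd|apply is_linear_snd].
Qed.

Lemma ndist_state (s p : state) :
  ndist s p ^ 2 =
    (Em_re s - Em_re p) ^ 2 + (Em_im s - Em_im p) ^ 2 + (Ep_re s - Ep_re p) ^ 2 +
    (Ep_im s - Ep_im p) ^ 2 + (carrier s - carrier p) ^ 2 + (spin s - spin p) ^ 2.
Proof.
assert (HC : forall z w : C_R_NormedModule,
          ndist z w ^ 2 = (fst z - fst w) ^ 2 + (snd z - snd w) ^ 2).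
{ intros z w; rewrite <- !ndist_R; exact (ndist_prod z w). }
unfold state; rewrite !ndist_prod, !HC, !ndist_R.
unfold Em_re, Em_im, Ep_re, Ep_im, carrier, spin; ring.
Qed.

Ltac lipschitz :=
  repeat first
    [ apply bounded_lipschitz_plus | apply bounded_lipschitz_minus
    | apply bounded_lipschitz_mult | apply bounded_lipschitz_opp
    | apply bounded_lipschitz_pow
    | apply bounded_lipschitz_const
    | apply bounded_lipschitz_linear;
      first [ apply is_linear_Em_re | apply is_linear_Em_im | apply is_linear_Ep_re
            | apply is_linear_Ep_im | apply is_linear_carrier | apply is_linear_spin ] ].

Lemma ndist_state_le (s p : state) :
  ndist s p <=
    Rabs (Em_re s - Em_re p) + Rabs (Em_im s - Em_im p) + Rabs (Ep_re s - Ep_re p) +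
    Rabs (Ep_im s - Ep_im p) + Rabs (carrier s - carrier p) + Rabs (spin s - spin p).
Proof.
pose proof (ndist_state s p) as H.
pose proof (Rabs_pos (Em_re s - Em_re p)); pose proof (Rabs_pos (Em_im s - Em_im p)).
pose proof (Rabs_pos (Ep_re s - Ep_re p)); pose proof (Rabs_pos (Ep_im s - Ep_im p)).
pose proof (Rabs_pos (carrier s - carrier p)); pose proof (Rabs_pos (spin s - spin p)).
rewrite <- (pow2_abs (Em_re s - Em_re p)), <- (pow2_abs (Em_im s - Em_im p)),
  <- (pow2_abs (Ep_re s - Ep_re p)), <- (pow2_abs (Ep_im s - Ep_im p)),
  <- (pow2_abs (carrier s - carrier p)), <- (pow2_abs (spin s - spin p)) in H.
apply Rnot_lt_le; intros Hlt.
set (a := Rabs (Em_re s - Em_re p)) in *; set (b := Rabs (Em_im s - Em_im p)) in *.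
set (c := Rabs (Ep_re s - Ep_re p)) in *; set (d := Rabs (Ep_im s - Ep_im p)) in *.
set (e := Rabs (carrier s - carrier p)) in *; set (f := Rabs (spin s - spin p)) in *.
assert ((a + b + c + d + e + f) ^ 2 < ndist s p ^ 2) by nra.
assert (a ^ 2 + b ^ 2 + c ^ 2 + d ^ 2 + e ^ 2 + f ^ 2 <= (a + b + c + d + e + f) ^ 2).
{ assert (0 <= a * b + (a + b) * c + (a + b + c) * d + (a + b + c + d) * e
               + (a + b + c + d + e) * f).
  { repeat apply Rplus_le_le_0_compat; apply Rmult_le_pos; lra. }
  nra. }
lra.
Qed.

Lemma laser_field_lipschitz (kappa gamma delta mu : R) (u : C * C) (p : state) (r : R) :
  exists L, 0 < L /\ forall x y, ndist x p <= r -> ndist y p <= r ->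
    ndist (laser_field kappa gamma delta mu u x) (laser_field kappa gamma delta mu u y)
    <= L * ndist x y.
Proof.
set (F := laser_field kappa gamma delta mu u).
set (D := fun x => ndist x p <= r).
assert (H1 : bounded_lipschitz D (fun x => Em_re (F x)))
  by (unfold F, laser_field, Em_re at 1, gain_m; simpl; unfold D; lipschitz).
assert (H2 : bounded_lipschitz D (fun x => Em_im (F x)))
  by (unfold F, laser_field, Em_im at 1, gain_m; simpl; unfold D; lipschitz).
assert (H3 : bounded_lipschitz D (fun x => Ep_re (F x)))
  by (unfold F, laser_field, Ep_re at 1, gain_p; simpl; unfold D; lipschitz).
assert (H4 : bounded_lipschitz D (fun x => Ep_im (F x)))
  by (unfold F, laser_field, Ep_im at 1, gain_p; simpl; unfold D; lipschitz).
assert (H5 : bounded_lipschitz D (fun x => carrier (F x)))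
  by (unfold F, laser_field, carrier at 1; simpl; unfold D; lipschitz).
assert (H6 : bounded_lipschitz D (fun x => spin (F x)))
  by (unfold F, laser_field, spin at 1; simpl; unfold D; lipschitz).
destruct H1 as (_ & L1 & _ & P1 & _ & H1); destruct H2 as (_ & L2 & _ & P2 & _ & H2).
destruct H3 as (_ & L3 & _ & P3 & _ & H3); destruct H4 as (_ & L4 & _ & P4 & _ & H4).
destruct H5 as (_ & L5 & _ & P5 & _ & H5); destruct H6 as (_ & L6 & _ & P6 & _ & H6).
exists (L1 + L2 + L3 + L4 + L5 + L6 + 1); split; [lra|].
intros x y Hx Hy.
apply Rle_trans with (1 := ndist_state_le _ _).
specialize (H1 x y Hx Hy); specialize (H2 x y Hx Hy); specialize (H3 x y Hx Hy).
specialize (H4 x y Hx Hy); specialize (H5 x y Hx Hy); specialize (H6 x y Hx Hy).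
pose proof (ndist_ge_0 x y); lra.
Qed.

Lemma coord_le_ndist (s p : state) (x : R) :
  x ^ 2 <= ndist s p ^ 2 -> Rabs x <= ndist s p.
Proof.
intros H; rewrite <- (pow2_abs x) in H.
pose proof (ndist_ge_0 s p); pose proof (Rabs_pos x).
apply Rnot_lt_le; intros Hlt; nra.
Qed.

Lemma carrier_le_ndist (s p : state) : Rabs (carrier s - carrier p) <= ndist s p.
Proof.
apply coord_le_ndist; rewrite ndist_state.
pose proof (pow2_ge_0 (Em_re s - Em_re p)); pose proof (pow2_ge_0 (Em_im s - Em_im p)).
pose proof (pow2_ge_0 (Ep_re s - Ep_re p)); pose proof (pow2_ge_0 (Ep_im s - Ep_im p)).
pose proof (pow2_ge_0 (spin s - spin p)); lra.
Qed.

Lemma spin_le_ndist (s p : state) : Rabs (spin s - spin p) <= ndist s p.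
Proof.
apply coord_le_ndist; rewrite ndist_state.
pose proof (pow2_ge_0 (Em_re s - Em_re p)); pose proof (pow2_ge_0 (Em_im s - Em_im p)).
pose proof (pow2_ge_0 (Ep_re s - Ep_re p)); pose proof (pow2_ge_0 (Ep_im s - Ep_im p)).
pose proof (pow2_ge_0 (carrier s - carrier p)); lra.
Qed.

(** * Stability read off the signs of the gains *)

Lemma gain_m_near (s p : state) : Rabs (gain_m s - gain_m p) <= 2 * ndist s p.
Proof.
pose proof (carrier_le_ndist s p) as H1; pose proof (spin_le_ndist s p) as H2.
apply Rabs_le_between in H1; apply Rabs_le_between in H2.
unfold gain_m; apply Rabs_le; lra.
Qed.

Lemma gain_p_near (s p : state) : Rabs (gain_p s - gain_p p) <= 2 * ndist s p.
Proof.
pose proof (carrier_le_ndist s p) as H1; pose proof (spin_le_ndist s p) as H2.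
apply Rabs_le_between in H1; apply Rabs_le_between in H2.
unfold gain_p; apply Rabs_le; lra.
Qed.

(** Let E = cre + i cim be the component with gain g, driven by the constant
    field ur + i ui.  Its part transverse to the driving field, that is
    l = Im (conj (ur + i ui) E), no longer sees the drive and obeys the scalar
    equation l' = - kappa g l.  It vanishes at the equilibrium, and where the
    gain stays below half its negative equilibrium value l^2 grows
    exponentially.  Both components of E are instances. *)
Lemma unstable_of_negative_gain (F : state -> state) (p : state)
    (cre cim g : state -> R) (kappa ur ui : R) :
  0 < kappa -> (ur, ui) <> (0, 0) ->
  is_linear (V := R_NormedModule) cre -> is_linear (V := R_NormedModule) cim ->
  (forall s, cre (F s) = - kappa * (g s * cre s - ur)) ->
  (forall s, cim (F s) = - kappa * (g s * cim s - ui)) ->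
  (forall s, Rabs (g s - g p) <= 2 * ndist s p) ->
  (forall al be, exists s, cre s = cre p + al /\ cim s = cim p + be /\
     ndist s p ^ 2 = al ^ 2 + be ^ 2) ->
  is_equilibrium F p -> g p < 0 ->
  unstable F p.
Proof.
intros Hk Hu Lre Lim Fre Fim Hg Hshift Heq Hneg.
set (l := fun s => ur * cim s - ui * cre s).
set (r := - g p / 4).
assert (Hr : 0 < r) by (unfold r; lra).
assert (Hu2 : 0 < ur ^ 2 + ui ^ 2).
{ apply Rnot_le_lt; intros Hle; apply Hu.
  pose proof (pow2_ge_0 ur); pose proof (pow2_ge_0 ui).
  assert (ur = 0) by nra; assert (ui = 0) by nra; congruence. }
assert (Hlp : l p = 0).
{ assert (E1 : cre (F p) = 0) by (rewrite Heq; apply (linear_zero _ Lre)).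
  assert (E2 : cim (F p) = 0) by (rewrite Heq; apply (linear_zero _ Lim)).
  rewrite Fre in E1; rewrite Fim in E2; unfold l.
  replace ur with (g p * cre p) by nra.
  replace ui with (g p * cim p) by nra; ring. }
assert (BL : forall q rho, bounded_lipschitz (fun x => ndist x q <= rho) (fun s => l s ^ 2)).
{ intros q rho; unfold l; apply bounded_lipschitz_pow, bounded_lipschitz_minus;
    (apply bounded_lipschitz_mult;
     [apply bounded_lipschitz_const | apply bounded_lipschitz_linear; assumption]). }
destruct (BL p r) as (M & _ & _ & _ & HM & _).
apply (instability F p (fun s => l s ^ 2) r (- kappa * g p) M); auto.
- nra.
- intros s.
  apply bounded_lipschitz_continuous, BL.
- intros s Hs; apply Rle_trans with (1 := Rle_abs _); apply HM; lra.
- intros phi t Hphi Hb.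
  pose proof (is_derive_linear (V := R_NormedModule) cre phi t _ Lre Hphi) as Dre.
  pose proof (is_derive_linear (V := R_NormedModule) cim phi t _ Lim Hphi) as Dim.
  rewrite Fre in Dre; rewrite Fim in Dim.
  exists (2 * (- kappa * g (phi t)) * l (phi t) ^ 2); split.
  + unfold l.
    pose proof (is_derive_weighted_sum _ _ _ _ _ ur (- ui) Dim Dre) as Dl.
    apply is_derive_square with (c := 0) in Dl.
    match type of Dl with is_derive _ _ ?v =>
      replace (2 * (- kappa * g (phi t)) * (ur * cim (phi t) - ui * cre (phi t)) ^ 2)
        with v by ring end.
    apply is_derive_ext with (2 := Dl); intros s; simpl; ring.
  + specialize (Hg (phi t)); apply Rabs_le_between in Hg.
    assert (g (phi t) <= g p / 2) by (unfold r in Hb; lra).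
    pose proof (pow2_ge_0 (l (phi t))).
    assert (- kappa * g p <= 2 * (- kappa * g (phi t))) by nra.
    nra.
- intros d Hd.
  set (tau := d / (2 * sqrt (ur ^ 2 + ui ^ 2))).
  pose proof (sqrt_lt_R0 _ Hu2) as Hsq.
  assert (Htau : 0 < tau) by (apply Rdiv_lt_0_compat; lra).
  assert (Etau : tau ^ 2 * (ur ^ 2 + ui ^ 2) = (d / 2) ^ 2).
  { rewrite <- (pow2_sqrt (ur ^ 2 + ui ^ 2)) at 1 by lra.
    unfold tau; field; lra. }
  (* A displacement of length d / 2 orthogonal to the driving field, the direction
     in which l is not stationary. *)
  destruct (Hshift (- tau * ui) (tau * ur)) as (s & Ere & Eim & Es).
  exists s; split.
  + pose proof (ndist_ge_0 s p).
    apply Rnot_le_lt; intros Hle.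
    assert (d ^ 2 <= ndist s p ^ 2) by (apply pow_incr; lra).
    nra.
  + replace (l s) with (tau * (ur ^ 2 + ui ^ 2)).
    * apply pow_lt; nra.
    * unfold l in *; rewrite Ere, Eim; nra.
Qed.

Lemma pair_neq_0 (z : C) : z <> RtoC 0 -> (fst z, snd z) <> (0, 0).
Proof. destruct z; intros H E; apply H; exact E. Qed.

Section Criteria.
Variables (kappa gamma delta mu : R) (u : C * C).
Hypothesis kappa_pos : 0 < kappa.
Hypothesis gamma_pos : 0 < gamma.
Hypothesis delta_pos : 0 < delta.
Let F := laser_field kappa gamma delta mu u.
Variable p : state.
Hypothesis p_eq : is_equilibrium F p.

Lemma unstable_of_gain_m : fst u <> RtoC 0 -> gain_m p < 0 -> unstable F p.
Proof.
intros Hu; apply (unstable_of_negative_gain F p Em_re Em_im gain_m kappa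
  (fst (fst u)) (snd (fst u))); auto using is_linear_Em_re, is_linear_Em_im, gain_m_near.
- apply pair_neq_0, Hu.
- intros al be.
  exists (((Em_re p + al, Em_im p + be), (Ep_re p, Ep_im p)), (carrier p, spin p)).
  rewrite ndist_state; unfold Em_re, Em_im, Ep_re, Ep_im, carrier, spin; simpl.
  split; [|split]; ring.
Qed.

Lemma unstable_of_gain_p : snd u <> RtoC 0 -> gain_p p < 0 -> unstable F p.
Proof.
intros Hu; apply (unstable_of_negative_gain F p Ep_re Ep_im gain_p kappa
  (fst (snd u)) (snd (snd u))); auto using is_linear_Ep_re, is_linear_Ep_im, gain_p_near.
- apply pair_neq_0, Hu.
- intros al be.
  exists (((Em_re p, Em_im p), (Ep_re p + al, Ep_im p + be)), (carrier p, spin p)).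
  rewrite ndist_state; unfold Em_re, Em_im, Ep_re, Ep_im, carrier, spin; simpl.
  split; [|split]; ring.
Qed.

Lemma equilibrium_coord (c : state -> R) :
  is_linear (V := R_NormedModule) c -> c (F p) = 0.
Proof. intros H; rewrite p_eq; apply (linear_zero _ H). Qed.

Lemma equilibrium_equations :
  gain_m p * Em_re p = fst (fst u) /\ gain_m p * Em_im p = snd (fst u) /\
  gain_p p * Ep_re p = fst (snd u) /\ gain_p p * Ep_im p = snd (snd u) /\
  carrier p + (Em_re p ^ 2 + Em_im p ^ 2) * (carrier p - spin p)
    + (Ep_re p ^ 2 + Ep_im p ^ 2) * (carrier p + spin p) = mu /\
  delta * spin p + (Ep_re p ^ 2 + Ep_im p ^ 2) * (carrier p + spin p)
    - (Em_re p ^ 2 + Em_im p ^ 2) * (carrier p - spin p) = 0.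
Proof.
assert (K : forall k x, 0 < k -> - k * x = 0 -> x = 0) by (intros; nra).
repeat split.
- pose proof (K _ _ kappa_pos (equilibrium_coord _ is_linear_Em_re)); lra.
- pose proof (K _ _ kappa_pos (equilibrium_coord _ is_linear_Em_im)); lra.
- pose proof (K _ _ kappa_pos (equilibrium_coord _ is_linear_Ep_re)); lra.
- pose proof (K _ _ kappa_pos (equilibrium_coord _ is_linear_Ep_im)); lra.
- pose proof (K _ _ gamma_pos (equilibrium_coord _ is_linear_carrier)); lra.
- pose proof (K _ _ gamma_pos (equilibrium_coord _ is_linear_spin)); lra.
Qed.

(** The weights of the field components are chosen so that, in the derivative
    along the flow, the terms that are linear in the deviation of E and linear
    in the deviation of (N, n) cancel exactly; see [energy_derive].  Note that
    1 - gain_m = N - n and 1 - gain_p = N + n. *)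
Definition energy (s : state) : R :=
  2 * (1 - gain_m p) / kappa * ((Em_re s - Em_re p) ^ 2 + (Em_im s - Em_im p) ^ 2) +
  2 * (1 - gain_p p) / kappa * ((Ep_re s - Ep_re p) ^ 2 + (Ep_im s - Ep_im p) ^ 2) +
  1 / gamma * ((carrier s - carrier p) ^ 2 + (spin s - spin p) ^ 2).

Definition dissipation (s : state) : R :=
  4 * (1 - gain_m p) * (gain_m p - ((carrier s - carrier p) - (spin s - spin p)) / 2)
    * ((Em_re s - Em_re p) ^ 2 + (Em_im s - Em_im p) ^ 2) +
  4 * (1 - gain_p p) * (gain_p p - ((carrier s - carrier p) + (spin s - spin p)) / 2)
    * ((Ep_re s - Ep_re p) ^ 2 + (Ep_im s - Ep_im p) ^ 2) +
  2 * ((carrier s - carrier p) ^ 2 + delta * (spin s - spin p) ^ 2 +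
       (Em_re s ^ 2 + Em_im s ^ 2) * ((carrier s - carrier p) - (spin s - spin p)) ^ 2 +
       (Ep_re s ^ 2 + Ep_im s ^ 2) * ((carrier s - carrier p) + (spin s - spin p)) ^ 2).

(** Write e and pi for the deviations of E_- and N - n from their values at p,
    and a for the gain of E_- at p.  Then e' = - kappa (a e - pi E_-), so that the
    derivative of |e|^2 contains the cross term 2 kappa pi Re (E_- conj e).  The
    carrier equations contain the change of |E_-|^2, which equals
    2 Re (E_- conj e) - |e|^2.  The weight 2 (1 - a) / kappa against 1 / gamma
    makes the cross terms cancel and leaves the remainder 2 pi (1 - a) |e|^2,
    which is absorbed into the coefficient a - pi / 2 of the dissipation. *)
Lemma energy_derive (phi : R -> state) (t : R) :
  is_derive phi t (F (phi t)) ->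
  is_derive (fun s => energy (phi s)) t (- dissipation (phi t)).
Proof.
intros Hphi.
pose proof (is_derive_linear (V := R_NormedModule) _ _ _ _ is_linear_Em_re Hphi) as D1.
pose proof (is_derive_linear (V := R_NormedModule) _ _ _ _ is_linear_Em_im Hphi) as D2.
pose proof (is_derive_linear (V := R_NormedModule) _ _ _ _ is_linear_Ep_re Hphi) as D3.
pose proof (is_derive_linear (V := R_NormedModule) _ _ _ _ is_linear_Ep_im Hphi) as D4.
pose proof (is_derive_linear (V := R_NormedModule) _ _ _ _ is_linear_carrier Hphi) as D5.
pose proof (is_derive_linear (V := R_NormedModule) _ _ _ _ is_linear_spin Hphi) as D6.
destruct equilibrium_equations as (E1 & E2 & E3 & E4 & E5 & E6).
pose proof (is_derive_weighted_sum _ _ _ _ _ 1 1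
  (is_derive_square _ _ _ (Em_re p) D1) (is_derive_square _ _ _ (Em_im p) D2)) as H1.
pose proof (is_derive_weighted_sum _ _ _ _ _ 1 1
  (is_derive_square _ _ _ (Ep_re p) D3) (is_derive_square _ _ _ (Ep_im p) D4)) as H2.
pose proof (is_derive_weighted_sum _ _ _ _ _ 1 1
  (is_derive_square _ _ _ (carrier p) D5) (is_derive_square _ _ _ (spin p) D6)) as H3.
pose proof (is_derive_weighted_sum _ _ _ _ _ 1 (1 / gamma)
  (is_derive_weighted_sum _ _ _ _ _ (2 * (1 - gain_m p) / kappa)
     (2 * (1 - gain_p p) / kappa) H1 H2) H3) as H.
match type of H with is_derive _ _ ?v => replace (- dissipation (phi t)) with v end.
{ apply is_derive_ext with (2 := H); intros s; unfold energy; simpl; ring. }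
clear - E1 E2 E3 E4 E5 E6 kappa_pos gamma_pos.
set (s := phi t); clearbody s.
unfold dissipation, F, laser_field.
rewrite <- E1, <- E2, <- E3, <- E4, <- E5.
set (e6 := delta * spin p + _ - _) in E6.
(* The equilibrium equation for n enters through this correction, since in
   general it cannot be solved for a parameter. *)
transitivity (- dissipation s - 2 * (spin s - spin p) * e6);
  [|rewrite E6; unfold dissipation; ring].
unfold e6, dissipation; clear - kappa_pos gamma_pos.
destruct s as [[[x1 y1] [x2 y2]] [N n]]; destruct p as [[[X1 Y1] [X2 Y2]] [M m]].
unfold gain_m, gain_p, Em_re, Em_im, Ep_re, Ep_im, carrier, spin; cbn [fst snd].
field; lra.
Qed.

Lemma energy_bounds :
  gain_m p < 1 -> gain_p p < 1 ->
  exists c1 c2, 0 < c1 /\ 0 < c2 /\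
    forall s, c1 * ndist s p ^ 2 <= energy s <= c2 * ndist s p ^ 2.
Proof.
intros Hm Hp.
assert (A : 0 < 2 * (1 - gain_m p) / kappa) by (apply Rdiv_lt_0_compat; lra).
assert (B : 0 < 2 * (1 - gain_p p) / kappa) by (apply Rdiv_lt_0_compat; lra).
assert (C : 0 < 1 / gamma) by (apply Rdiv_lt_0_compat; lra).
unfold energy.
set (A' := 2 * (1 - gain_m p) / kappa) in *.
set (B' := 2 * (1 - gain_p p) / kappa) in *; set (C' := 1 / gamma) in *.
exists (Rmin A' (Rmin B' C')), (A' + B' + C').
assert (K1 := Rmin_l A' (Rmin B' C')); assert (K2 := Rmin_r A' (Rmin B' C')).
assert (K3 := Rmin_l B' C'); assert (K4 := Rmin_r B' C').
split; [repeat apply Rmin_pos; assumption|]; split; [lra|].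
set (c1 := Rmin A' (Rmin B' C')) in *.
intros s; rewrite ndist_state.
pose proof (pow2_ge_0 (Em_re s - Em_re p)); pose proof (pow2_ge_0 (Em_im s - Em_im p)).
pose proof (pow2_ge_0 (Ep_re s - Ep_re p)); pose proof (pow2_ge_0 (Ep_im s - Ep_im p)).
pose proof (pow2_ge_0 (carrier s - carrier p)); pose proof (pow2_ge_0 (spin s - spin p)).
split; nra.
Qed.

(** Close to p the deviations of N - n and N + n are at most the gains, so the
    coefficients a - pi / 2 of the dissipation keep at least half their
    equilibrium value; the two terms with |E_-|^2 and |E_+|^2 are nonnegative
    and can be dropped. *)
Lemma dissipation_bound (c : R) (s : state) :
  0 < gain_m p < 1 -> 0 < gain_p p < 1 ->
  c <= kappa * gain_m p -> c <= kappa * gain_p p -> c <= 2 * gamma ->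
  c <= 2 * gamma * delta ->
  2 * ndist s p <= gain_m p -> 2 * ndist s p <= gain_p p ->
  c * energy s <= dissipation s.
Proof.
intros Hm Hp C1 C2 C3 C4 Sm Sp.
pose proof (carrier_le_ndist s p) as H1; pose proof (spin_le_ndist s p) as H2.
apply Rabs_le_between in H1; apply Rabs_le_between in H2.
unfold energy, dissipation.
set (nu := carrier s - carrier p) in *; set (eta := spin s - spin p) in *.
set (e1 := (Em_re s - Em_re p) ^ 2 + (Em_im s - Em_im p) ^ 2).
set (e2 := (Ep_re s - Ep_re p) ^ 2 + (Ep_im s - Ep_im p) ^ 2).
assert (P1 : 0 <= e1) by (apply Rplus_le_le_0_compat; apply pow2_ge_0).
assert (P2 : 0 <= e2) by (apply Rplus_le_le_0_compat; apply pow2_ge_0).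
assert (Q1 : 0 <= (Em_re s ^ 2 + Em_im s ^ 2) * (nu - eta) ^ 2).
{ apply Rmult_le_pos; [apply Rplus_le_le_0_compat|]; apply pow2_ge_0. }
assert (Q2 : 0 <= (Ep_re s ^ 2 + Ep_im s ^ 2) * (nu + eta) ^ 2).
{ apply Rmult_le_pos; [apply Rplus_le_le_0_compat|]; apply pow2_ge_0. }
pose proof (pow2_ge_0 nu) as N1; pose proof (pow2_ge_0 eta) as N2.
assert (R1 : c * (2 * (1 - gain_m p) / kappa * e1)
             <= 4 * (1 - gain_m p) * (gain_m p - (nu - eta) / 2) * e1).
{ replace (c * (2 * (1 - gain_m p) / kappa * e1))
    with (2 * (1 - gain_m p) * e1 * (c / kappa)) by (field; lra).
  assert (c / kappa <= gain_m p) by (apply Rle_div_l; lra).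
  apply Rle_trans with (2 * (1 - gain_m p) * e1 * (2 * (gain_m p - (nu - eta) / 2)));
    [|apply Req_le; ring].
  apply Rmult_le_compat_l; [apply Rmult_le_pos|]; lra. }
assert (R2 : c * (2 * (1 - gain_p p) / kappa * e2)
             <= 4 * (1 - gain_p p) * (gain_p p - (nu + eta) / 2) * e2).
{ replace (c * (2 * (1 - gain_p p) / kappa * e2))
    with (2 * (1 - gain_p p) * e2 * (c / kappa)) by (field; lra).
  assert (c / kappa <= gain_p p) by (apply Rle_div_l; lra).
  apply Rle_trans with (2 * (1 - gain_p p) * e2 * (2 * (gain_p p - (nu + eta) / 2)));
    [|apply Req_le; ring].
  apply Rmult_le_compat_l; [apply Rmult_le_pos|]; lra. }
assert (R3 : c * (1 / gamma * nu ^ 2) <= 2 * nu ^ 2).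
{ replace (c * (1 / gamma * nu ^ 2)) with (c / gamma * nu ^ 2) by (field; lra).
  apply Rmult_le_compat_r; [lra|]; apply Rle_div_l; lra. }
assert (R4 : c * (1 / gamma * eta ^ 2) <= 2 * (delta * eta ^ 2)).
{ replace (c * (1 / gamma * eta ^ 2)) with (c / gamma * eta ^ 2) by (field; lra).
  rewrite <- Rmult_assoc; apply Rmult_le_compat_r; [lra|]; apply Rle_div_l; lra. }
lra.
Qed.

Lemma asymptotically_stable_of_gain :
  0 < gain_m p < 1 -> 0 < gain_p p < 1 -> asymptotically_stable F p.
Proof.
intros Hm Hp.
destruct (energy_bounds (proj2 Hm) (proj2 Hp)) as (c1 & c2 & Hc1 & Hc2 & Hb).
set (r := Rmin (gain_m p) (gain_p p) / 2).
pose proof (Rmin_l (gain_m p) (gain_p p)) as M1.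
pose proof (Rmin_r (gain_m p) (gain_p p)) as M2.
assert (Hr : 0 < r).
{ apply Rdiv_lt_0_compat; [apply Rmin_pos|]; lra. }
set (c := Rmin (Rmin (kappa * gain_m p) (kappa * gain_p p))
               (Rmin (2 * gamma) (2 * gamma * delta))).
assert (Hc : 0 < c) by (repeat apply Rmin_pos; repeat apply Rmult_lt_0_compat; lra).
destruct (laser_field_lipschitz kappa gamma delta mu u p r) as (L & HL & Hlip).
apply (lyapunov_direct (V := complete_state) F p energy r c1 c2 c L); auto.
- intros s; apply (bounded_lipschitz_continuous (V := state)).
  unfold energy; lipschitz.
- intros s; apply Hb.
- intros s; apply Hb.
- intros phi t Hphi Hn; exists (- dissipation (phi t)); split.
  + apply energy_derive, Hphi.
  + assert (c * energy (phi t) <= dissipation (phi t)); [|lra].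
    change (ndist (V := state) (phi t) p < r) in Hn.
    pose proof (Rmin_l (Rmin (kappa * gain_m p) (kappa * gain_p p))
               (Rmin (2 * gamma) (2 * gamma * delta))).
    pose proof (Rmin_r (Rmin (kappa * gain_m p) (kappa * gain_p p))
               (Rmin (2 * gamma) (2 * gamma * delta))).
    pose proof (Rmin_l (kappa * gain_m p) (kappa * gain_p p)).
    pose proof (Rmin_r (kappa * gain_m p) (kappa * gain_p p)).
    pose proof (Rmin_l (2 * gamma) (2 * gamma * delta)).
    pose proof (Rmin_r (2 * gamma) (2 * gamma * delta)).
    apply dissipation_bound; unfold c, r in *; lra.
Qed.
End Criteria.

(** * Signs of the gains along the branches *)

Lemma locally'_pdisc (P : C -> Prop) :
  locally' (0 : C) P <-> exists d, 0 < d /\ forall lam, in_pdisc d lam -> P lam.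
Proof.
split.
- intros H; destruct H as [d Hd]; exists d; split; [apply cond_pos|].
  intros lam [H0 H1]; apply Hd.
  + apply (norm_compat1 (V := C_NormedModule)).
    change (Cmod (lam - 0)%C < d).
    replace (lam - 0)%C with lam by ring; exact H1.
  + intros E; rewrite E, Cmod_0 in H0; lra.
- intros (d & Hd & H).
  assert (Hl : locally (0 : C) (fun lam => Cmod lam < d)).
  { apply (locally_le_locally_norm (V := C_NormedModule)).
    exists (mkposreal d Hd); intros z Hlam; set (lam := z : C).
    change (Cmod (lam - 0)%C < d) in Hlam.
    replace (lam - 0)%C with lam in Hlam by ring; exact Hlam. }
  unfold locally', within; revert Hl; apply filter_imp; intros lam Hlt Hne.
  apply H; split; [apply Cmod_gt_0, Hne|exact Hlt].
Qed.

Lemma Cmod_phase (z : C) : z <> 0%C -> Cmod (phase z) = 1.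
Proof.
intros Hz; unfold phase.
pose proof (proj1 (Cmod_gt_0 z) Hz) as Hp.
rewrite Cmod_div by (intros E; apply RtoC_inj in E; lra).
rewrite Cmod_R, Rabs_pos_eq by lra; field; lra.
Qed.

Lemma phase_neq_0 (z : C) : z <> 0%C -> phase z <> 0%C.
Proof.
intros Hz E; apply Cmod_phase in Hz; rewrite E, Cmod_0 in Hz; lra.
Qed.

Lemma phase_polar (z : C) : z <> 0%C -> z = (phase z * Cmod z)%C.
Proof.
intros Hz; unfold phase; field.
intros E; apply RtoC_inj in E; apply Cmod_gt_0 in Hz; lra.
Qed.

(** All vectors in the equilibrium equation are multiples of the phase of
    lam v up to the remainder rho; dividing by that phase and taking real parts
    turns it into a real equation for the gain. *)
Lemma gain_identity (lam v rho : C) (ell w a : R) :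
  lam <> 0%C -> v <> 0%C ->
  (RtoC a * (phase lam * ((RtoC ell * phase v + RtoC (Cmod lam) * (RtoC w * v)) + rho))
   = lam * v)%C ->
  exists e, Rabs e <= Cmod rho /\
    a * (ell + Cmod lam * w * Cmod v + e) = Cmod lam * Cmod v.
Proof.
intros Hlam Hv H.
exists (Re (rho / phase v)%C); split.
- apply Rle_trans with (Cmod (rho / phase v)).
  + apply Rle_trans with (2 := Rmax_Cmod _); apply Rmax_l.
  + rewrite Cmod_div, Cmod_phase by (try apply phase_neq_0; assumption).
    unfold Rdiv; rewrite Rinv_1; lra.
- assert (E : (RtoC a * (RtoC ell + RtoC (Cmod lam) * RtoC w * RtoC (Cmod v)
                         + rho / phase v) = RtoC (Cmod lam * Cmod v))%C).
  { pose proof (phase_neq_0 lam Hlam) as N1; pose proof (phase_neq_0 v Hv) as N2.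
    rewrite (phase_polar lam Hlam) in H at 3; rewrite (phase_polar v Hv) in H at 2 3.
    set (pl := phase lam) in *; set (pv := phase v) in *.
    rewrite RtoC_mult.
    transitivity ((pl * Cmod lam * (pv * Cmod v)) / (pl * pv))%C.
    - rewrite <- H; field; split; assumption.
    - field; split; assumption. }
  apply (f_equal Re) in E.
  set (z := (rho / phase v)%C) in *.
  destruct z as [z1 z2]; unfold Re in *; cbn in E; cbn; lra.
Qed.

Section SmallGain.
Variables (v : C) (ell w : R) (rest : C -> C).
Hypothesis v_neq_0 : v <> 0%C.
Hypothesis rest_small : is_domin (Ku := C_AbsRing) (Kv := C_AbsRing)
  (U := C_NormedModule) (V := C_NormedModule) (locally' (0 : C)) (fun lam => lam) rest.

(** The equilibrium equation for one field component, with driving field lam v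
    and with the asymptotic form of the component inserted. *)
Definition gain_along (lam : C) (a : R) : Prop :=
  (RtoC a * (phase lam * ((RtoC ell * phase v + RtoC (Cmod lam) * (RtoC w * v)) + rest lam))
   = lam * v)%C.

Lemma gain_along_approx (eps : R) : 0 < eps ->
  locally' (0 : C) (fun lam => 0 < Cmod lam < eps /\ forall a, gain_along lam a ->
    exists e, Rabs e <= eps * Cmod lam /\
      a * (ell + Cmod lam * w * Cmod v + e) = Cmod lam * Cmod v).
Proof.
intros Heps.
assert (H1 : locally' (0 : C) (fun lam => 0 < Cmod lam < eps)).
{ apply locally'_pdisc; exists eps; split; [exact Heps|]; intros lam H; exact H. }
generalize (filter_and _ _ H1 (rest_small (mkposreal eps Heps))); apply filter_imp.
intros lam [Hlam Hrest]; split; [exact Hlam|]; intros a Ha.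
change (Cmod (rest lam) <= eps * Cmod lam) in Hrest.
destruct (gain_identity lam v (rest lam) ell w a) as (e & He & E); auto.
- apply Cmod_gt_0; lra.
- exists e; split; [lra|exact E].
Qed.

(** The gain a times the signed amplitude of the component equals the positive
    number |lam| |v|; a negative leading amplitude, or a vanishing one together
    with a negative slope, makes the amplitude negative for small lam. *)
Lemma gain_negative :
  ell <= 0 -> (ell = 0 -> w < 0) ->
  locally' (0 : C) (fun lam => forall a, gain_along lam a -> a < 0).
Proof.
intros Hell Hw.
pose proof (proj1 (Cmod_gt_0 v) v_neq_0) as Hv.
assert (Heps : exists eps, 0 < eps /\ forall t e, 0 < t < eps -> Rabs e <= eps * t ->
          ell + t * w * Cmod v + e < 0).
{ destruct (Req_dec ell 0) as [E|E].
  - exists (- w * Cmod v / 2); specialize (Hw E); split; [nra|].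
    intros t e Ht He; apply Rabs_le_between in He.
    assert (t * (w * Cmod v) < 0) by nra; nra.
  - set (k := Rabs w * Cmod v + 1).
    assert (Hk : 1 <= k) by (pose proof (Rabs_pos w); unfold k; nra).
    assert (Hq : 0 < - ell / (2 * k)) by (apply Rdiv_lt_0_compat; lra).
    exists (Rmin 1 (- ell / (2 * k))); split; [apply Rmin_pos; lra|].
    pose proof (Rmin_l 1 (- ell / (2 * k))) as M1.
    pose proof (Rmin_r 1 (- ell / (2 * k))) as M2.
    intros t e Ht He; apply Rabs_le_between in He.
    assert (Htk : t * (2 * k) < - ell) by (apply Rlt_div_r; lra).
    assert (t * w * Cmod v <= t * (Rabs w * Cmod v)).
    { rewrite Rmult_assoc; apply Rmult_le_compat_l; [lra|].
      apply Rmult_le_compat_r; [lra|apply Rle_abs]. }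
    unfold k in *; nra. }
destruct Heps as (eps & Heps & Hsign).
generalize (gain_along_approx eps Heps); apply filter_imp.
intros lam [Hlam H] a Ha; destruct (H a Ha) as (e & He & E).
specialize (Hsign _ _ Hlam He).
assert (0 < Cmod lam * Cmod v) by nra; nra.
Qed.

(** The gain a equals |lam| |v| divided by an amplitude that stays away from 0. *)
Lemma gain_small_positive :
  0 < ell -> locally' (0 : C) (fun lam => forall a, gain_along lam a -> 0 < a < 1).
Proof.
intros Hell.
pose proof (proj1 (Cmod_gt_0 v) v_neq_0) as Hv.
set (k := Rabs w * Cmod v + 1 + Cmod v).
assert (Hk : 1 <= k) by (pose proof (Rabs_pos w); unfold k; nra).
assert (Hq : 0 < ell / k) by (apply Rdiv_lt_0_compat; lra).
assert (Heps : 0 < Rmin 1 (ell / k)) by (apply Rmin_pos; lra).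
pose proof (Rmin_l 1 (ell / k)) as M1; pose proof (Rmin_r 1 (ell / k)) as M2.
generalize (gain_along_approx _ Heps); apply filter_imp.
intros lam [Hlam H] a Ha; destruct (H a Ha) as (e & He & E).
apply Rabs_le_between in He.
set (t := Cmod lam) in *.
assert (Htk : t * k < ell) by (apply Rlt_div_r; lra).
assert (- (t * (Rabs w * Cmod v)) <= t * w * Cmod v).
{ rewrite Rmult_assoc, <- Ropp_mult_distr_r_reverse; apply Rmult_le_compat_l; [lra|].
  rewrite Ropp_mult_distr_l; apply Rmult_le_compat_r; [lra|].
  pose proof (Rle_abs (- w)) as Hw; rewrite Rabs_Ropp in Hw; lra. }
assert (t * Cmod v < ell + t * w * Cmod v + e) by (unfold k in *; nra).
assert (0 < t * Cmod v) by nra.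
split; nra.
Qed.
End SmallGain.

Section Branches.
Variables (delta mu : R) (uh : C * C).
Hypothesis delta_pos : 0 < delta.
Hypothesis mu_gt_1 : 1 < mu.

Definition ampLR : R := sqrt (delta * (mu - 1) / (1 + delta)).
Definition ampXY : R := sqrt ((mu - 1) / 2).

Lemma ampLR_pos : 0 < ampLR.
Proof. apply sqrt_lt_R0, Rdiv_lt_0_compat; nra. Qed.

Lemma ampXY_pos : 0 < ampXY.
Proof. apply sqrt_lt_R0; lra. Qed.

(** The signed amplitude of the leading term, in units of the phase of the
    injected field component. *)
Definition amp_m (j : branch) : R :=
  match j with
  | pL => ampLR | mL => - ampLR
  | pX | pY => ampXY | mX | mY => - ampXY
  | b0 | pR | mR => 0
  end.

Definition amp_p (j : branch) : R :=
  match j with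
  | pR => ampLR | mR => - ampLR
  | pX | mY => ampXY | mX | pY => - ampXY
  | b0 | pL | mL => 0
  end.

(** Among the nine branches only +X has both leading amplitudes positive. *)
Lemma amp_nonpos (j : branch) : j <> pX -> amp_m j <= 0 \/ amp_p j <= 0.
Proof.
pose proof ampLR_pos; pose proof ampXY_pos.
destruct j; intros Hj; simpl; try (now elim Hj); first [left; lra | right; lra].
Qed.

Lemma leading_m (j : branch) :
  fst (leading delta mu uh j) = (RtoC (amp_m j) * phase (fst uh))%C.
Proof.
unfold leading, amp_m; fold ampLR ampXY; set (z := phase _); set (z' := phase _).
destruct j; apply injective_projections; cbn; ring.
Qed.

Lemma leading_p (j : branch) :
  snd (leading delta mu uh j) = (RtoC (amp_p j) * phase (snd uh))%C.
Proof.
unfold leading, amp_p; fold ampLR ampXY; set (z := phase _); set (z' := phase _).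
destruct j; apply injective_projections; cbn; ring.
Qed.

(** A component that vanishes at leading order points against the injected
    field at first order. *)
Lemma what_m (j : branch) : exists w, (amp_m j = 0 -> w < 0) /\
  fst (what delta mu uh j) = (RtoC w * fst uh)%C.
Proof.
pose proof ampLR_pos as PL; pose proof ampXY_pos as PX.
assert (PM : 0 < / (2 * (mu - 1))) by (apply Rinv_0_lt_compat; lra).
assert (P0 : 0 < / (mu - 1)) by (apply Rinv_0_lt_compat; lra).
destruct j; eexists;
  (split; [|unfold what; simpl; rewrite ?Cmult_assoc, <- ?RtoC_mult; reflexivity]);
  simpl; intros E; unfold Rdiv; first [lra | nra].
Qed.

Lemma what_p (j : branch) : exists w, (amp_p j = 0 -> w < 0) /\
  snd (what delta mu uh j) = (RtoC w * snd uh)%C.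
Proof.
pose proof ampLR_pos as PL; pose proof ampXY_pos as PX.
assert (PM : 0 < / (2 * (mu - 1))) by (apply Rinv_0_lt_compat; lra).
assert (P0 : 0 < / (mu - 1)) by (apply Rinv_0_lt_compat; lra).
destruct j; eexists;
  (split; [|unfold what; simpl; rewrite ?Cmult_assoc, <- ?RtoC_mult; reflexivity]);
  simpl; intros E; unfold Rdiv; first [lra | nra].
Qed.

End Branches.

(** * Stability of the nine branches *)

Lemma filter_forall_branch {T : Type} {F : (T -> Prop) -> Prop} {FF : Filter F}
    (P : branch -> T -> Prop) :
  (forall j, F (P j)) -> F (fun x => forall j, P j x).
Proof.
intros H.
apply filter_imp with (fun x => P b0 x /\ (P pL x /\ P mL x) /\ (P pR x /\ P mR x) /\
  (P pX x /\ P mX x) /\ (P pY x /\ P mY x)).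
- intros x Hx j; destruct j; tauto.
- repeat apply filter_and; apply H.
Qed.

Lemma is_domin_fst (f : C -> C_NormedModule) (g : C -> C2) :
  is_domin (locally' (0 : C)) f g -> is_domin (locally' (0 : C)) f (fun x => fst (g x)).
Proof. intros H; apply (is_domin_linear f g fst); [apply is_linear_fst|exact H]. Qed.

Lemma is_domin_snd (f : C -> C_NormedModule) (g : C -> C2) :
  is_domin (locally' (0 : C)) f g -> is_domin (locally' (0 : C)) f (fun x => snd (g x)).
Proof. intros H; apply (is_domin_linear f g snd); [apply is_linear_snd|exact H]. Qed.

Section Main.
Variables (kappa gamma delta mu : R) (uh : C * C) (l : R) (Eb : branch -> C -> C2).
Hypothesis kappa_pos : 0 < kappa.
Hypothesis gamma_pos : 0 < gamma.
Hypothesis delta_pos : 0 < delta.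
Hypothesis mu_gt_1 : 1 < mu.
Hypothesis um_neq_0 : fst uh <> RtoC 0.
Hypothesis up_neq_0 : snd uh <> RtoC 0.
Hypothesis l_pos : 0 < l.
Hypothesis equilibria : determines_equilibria kappa gamma delta mu 0 uh l Eb.
Hypothesis asymptotics : has_asymptotics delta mu uh l Eb.

Let F (lam : C) := laser_field kappa gamma delta mu (scal lam (uh : C2)).
Let pt (j : branch) (lam : C) : state := state_of delta mu (Eb j lam).

Lemma rhs_eq (lam : C) : rhs kappa gamma delta mu 0 (scal lam (uh : C2)) = F lam.
Proof. apply functional_extensionality; intros s; apply rhs_laser_field. Qed.

Lemma branch_equilibrium (j : branch) (lam : C) :
  in_pdisc l lam -> is_equilibrium (F lam) (pt j lam).
Proof.
intros Hlam; rewrite <- rhs_eq; unfold pt, state_of.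
rewrite (surjective_pairing (y delta mu _)).
apply equilibria; [exact Hlam|].
exists j; split; [reflexivity|]; symmetry; apply surjective_pairing.
Qed.

Lemma near_0_in_pdisc : locally' (0 : C) (in_pdisc l).
Proof. apply locally'_pdisc; exists l; auto. Qed.

Lemma gain_m_equation (j : branch) (lam : C) : in_pdisc l lam ->
  (RtoC (gain_m (pt j lam)) * fst (Eb j lam) = lam * fst uh)%C.
Proof.
intros Hlam.
destruct (equilibrium_equations _ _ _ _ _ kappa_pos gamma_pos _
  (branch_equilibrium j lam Hlam)) as (E1 & E2 & _).
change (lam * fst uh)%C with (fst (scal lam (uh : C2))).
apply injective_projections; [etransitivity; [|exact E1]|etransitivity; [|exact E2]];
  unfold Em_re, Em_im, pt, state_of; simpl; ring.
Qed.

Lemma gain_p_equation (j : branch) (lam : C) : in_pdisc l lam ->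
  (RtoC (gain_p (pt j lam)) * snd (Eb j lam) = lam * snd uh)%C.
Proof.
intros Hlam.
destruct (equilibrium_equations _ _ _ _ _ kappa_pos gamma_pos _
  (branch_equilibrium j lam Hlam)) as (_ & _ & E1 & E2 & _).
change (lam * snd uh)%C with (snd (scal lam (uh : C2))).
apply injective_projections; [etransitivity; [|exact E1]|etransitivity; [|exact E2]];
  unfold Ep_re, Ep_im, pt, state_of; simpl; ring.
Qed.

Lemma gain_m_along (j : branch) : exists w rest,
  (amp_m delta mu j = 0 -> w < 0) /\
  is_domin (Ku := C_AbsRing) (Kv := C_AbsRing) (U := C_NormedModule)
    (V := C_NormedModule) (locally' (0 : C)) (fun lam => lam) rest /\
  forall lam, in_pdisc l lam ->
    gain_along (fst uh) (amp_m delta mu j) w rest lam (gain_m (pt j lam)).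
Proof.
destruct (asymptotics j) as (rest & Hrest & HE).
destruct (what_m delta mu uh delta_pos mu_gt_1 j) as (w & Hw & Ew).
exists w, (fun lam => fst (rest lam)); split; [exact Hw|].
split; [apply is_domin_fst, Hrest|].
intros lam Hlam; unfold gain_along.
rewrite <- leading_m, <- Ew, <- (gain_m_equation j lam Hlam), (HE lam Hlam).
reflexivity.
Qed.

Lemma gain_p_along (j : branch) : exists w rest,
  (amp_p delta mu j = 0 -> w < 0) /\
  is_domin (Ku := C_AbsRing) (Kv := C_AbsRing) (U := C_NormedModule)
    (V := C_NormedModule) (locally' (0 : C)) (fun lam => lam) rest /\
  forall lam, in_pdisc l lam ->
    gain_along (snd uh) (amp_p delta mu j) w rest lam (gain_p (pt j lam)).
Proof.
destruct (asymptotics j) as (rest & Hrest & HE).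
destruct (what_p delta mu uh delta_pos mu_gt_1 j) as (w & Hw & Ew).
exists w, (fun lam => snd (rest lam)); split; [exact Hw|].
split; [apply is_domin_snd, Hrest|].
intros lam Hlam; unfold gain_along.
rewrite <- leading_p, <- Ew, <- (gain_p_equation j lam Hlam), (HE lam Hlam).
reflexivity.
Qed.

Lemma branch_unstable (j : branch) : j <> pX ->
  locally' (0 : C) (fun lam => unstable (F lam) (pt j lam)).
Proof.
intros Hj; destruct (amp_nonpos delta mu delta_pos mu_gt_1 j Hj) as [Ha|Ha].
- destruct (gain_m_along j) as (w & rest & Hw & Hrest & Halong).
  generalize (filter_and _ _ near_0_in_pdisc
    (gain_negative _ _ _ _ um_neq_0 Hrest Ha Hw)); apply filter_imp.
  intros lam [Hlam Hneg].
  apply unstable_of_gain_m; [exact kappa_pos|now apply branch_equilibrium| |].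
  + apply Cmult_neq_0; [apply Cmod_gt_0, Hlam|exact um_neq_0].
  + apply Hneg, Halong, Hlam.
- destruct (gain_p_along j) as (w & rest & Hw & Hrest & Halong).
  generalize (filter_and _ _ near_0_in_pdisc
    (gain_negative _ _ _ _ up_neq_0 Hrest Ha Hw)); apply filter_imp.
  intros lam [Hlam Hneg].
  apply unstable_of_gain_p; [exact kappa_pos|now apply branch_equilibrium| |].
  + apply Cmult_neq_0; [apply Cmod_gt_0, Hlam|exact up_neq_0].
  + apply Hneg, Halong, Hlam.
Qed.

Lemma pX_stable :
  locally' (0 : C) (fun lam => asymptotically_stable (F lam) (pt pX lam)).
Proof.
destruct (gain_m_along pX) as (w & rest & _ & Hrest & Halong).
destruct (gain_p_along pX) as (w' & rest' & _ & Hrest' & Halong').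
pose proof (ampXY_pos mu mu_gt_1) as Hamp.
generalize (filter_and _ _ near_0_in_pdisc (filter_and _ _
  (gain_small_positive _ _ w _ um_neq_0 Hrest Hamp)
  (gain_small_positive _ _ w' _ up_neq_0 Hrest' Hamp))); apply filter_imp.
intros lam (Hlam & Hm & Hp).
apply asymptotically_stable_of_gain; auto; now apply branch_equilibrium.
Qed.
End Main.

Theorem theorem12 :
  forall (kappa gamma delta mu : R),
    0 < kappa -> 0 < gamma -> 0 < delta -> 1 < mu ->
  forall uh : C * C, fst uh <> RtoC 0 -> snd uh <> RtoC 0 ->
  forall l : R, 0 < l ->
  forall Eb : branch -> C -> C2,
    (forall (j : branch) (lam : C), in_pdisc l lam ->
       continuous (T := C_UniformSpace) (U := C2) (Eb j) lam) ->
    (forall (j k : branch) (lam : C), in_pdisc l lam ->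
       j <> k -> Eb j lam <> Eb k lam) ->
    determines_equilibria kappa gamma delta mu 0 uh l Eb ->
    has_asymptotics delta mu uh l Eb ->
  exists l0 : R, 0 < l0 <= l /\
    forall lam : C, in_pdisc l0 lam ->
      let F := rhs kappa gamma delta mu 0 (scal lam (uh : C2)) in
      asymptotically_stable F (state_of delta mu (Eb pX lam)) /\
      forall j : branch, j <> pX ->
        unstable F (state_of delta mu (Eb j lam)).
Proof.
intros kappa gamma delta mu Hk Hg Hd Hmu uh Hum Hup l Hl Eb _ _ Heq Has.
assert (Hnear : locally' (0 : C) (fun lam =>
  asymptotically_stable (laser_field kappa gamma delta mu (scal lam (uh : C2)))
    (state_of delta mu (Eb pX lam)) /\
  forall j, j <> pX ->
    unstable (laser_field kappa gamma delta mu (scal lam (uh : C2)))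
      (state_of delta mu (Eb j lam)))).
{ apply filter_and.
  - now apply pX_stable with l.
  - apply filter_forall_branch; intros j.
    destruct (classic (j = pX)) as [E|Hj].
    + apply filter_forall; intros lam Hj; contradiction.
    + generalize (branch_unstable kappa gamma delta mu uh l Eb
        Hk Hg Hd Hmu Hum Hup Hl Heq Has j Hj).
      apply filter_imp; auto. }
apply locally'_pdisc in Hnear; destruct Hnear as (d & Hdpos & H).
exists (Rmin d l); split; [split; [apply Rmin_pos; assumption|apply Rmin_r]|].
intros lam [Hlam0 Hlam]; cbv zeta; rewrite rhs_eq.
apply H; split; [exact Hlam0|].
apply Rlt_le_trans with (1 := Hlam); apply Rmin_l.
Qed.
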